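(* Let $N\ge 1$, $\alpha\in\mathbb{C}$, and let $u_0,\ldots,u_N\in\mathbb{C}\setminus\Lambda_\tau$ be such that every function value below is defined. (a) For all $r,s\in\{0,\ldots,N\}$, the value of $\hat\mu_N$ at the point obtained from $(u_0,\ldots,u_N)$ by replacing $u_r$ with $u_r+\tau$ equals its value at the point obtained by replacing $u_s$ with $u_s+\tau$: $$\hat\mu_N(\ldots,u_r+\tau,\ldots;\alpha;\tau)=\hat\mu_N(\ldots,u_s+\tau,\ldots;\alpha;\tau).$$ (b) For every permutation $\sigma$ of $\{0,\ldots,N\}$, $$\hat\mu_N(u_0,\ldots,u_N;\alpha;\tau)=\hat\mu_N(u_{\sigma(0)},\ldots,u_{\sigma(N)};\alpha;\tau).$$
   Context: Fix $\tau\in\mathbb{C}$ with $\operatorname{Im}\tau>0$, put $q=e^{2\pi i\tau}$, $\Lambda_\tau=\mathbb{Z}+\tau\mathbb{Z}$, and $q^{\beta}:=e^{2\pi i\beta\tau}$ for $\beta\in\mathbb{C}$. $(x;q)_\infty=\prod_{j\ge0}(1-xq^j)$. The theta function is $\vartheta(u)=\vartheta(u;\tau)=\sum_{\nu\in\mathbb{Z}+1/2}e^{2\pi i\nu(u+1/2)}q^{\nu^2/2}=-ie^{-\pi iu}q^{1/8}(q;q)_\infty(e^{2\pi iu};q)_\infty(qe^{-2\pi iu};q)_\infty$. For $n=(n_1,\ldots,n_N)\in\mathbb{Z}^N$ put $|n|=n_1+\cdots+n_N$, and put $u=u_0+\cdots+u_N$. The multivariable generalized $\mu$-function is $$\hat\mu_N(u_0,\ldots,u_N;\alpha;\tau)=e^{\pi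 i(\alpha-1)u}\sum_{n\in\mathbb{Z}^N}\frac{e^{\pi iu_0}\,(e^{2\pi iu_0}q^{\alpha+|n|};q)_\infty}{(e^{2\pi iu_0}q^{|n|};q)_\infty}\prod_{j=1}^N\frac{(-1)^{n_j}e^{-2\pi in_ju_j}q^{n_j(n_j+1)/2}}{\vartheta(u_j;\tau)},$$ defined for $u_0,\ldots,u_N\notin\Lambda_\tau$. *)

(* Defs.v *)
From Stdlib Require Import Reals ZArith List.
From Coquelicot Require Import Coquelicot.

Open Scope C_scope.

Definition cexp (z : C) : C :=
  (exp (Re z) * cos (Im z), exp (Re z) * sin (Im z))%R.

(* Limit of a complex sequence (the value is meaningful when the sequence
   converges; limits in C are unique). *)
Definition limC (s : nat -> C) : C :=
  @iota (CompleteNormedModule.CompleteSpace _ C_CompleteNormedModule)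
    (fun l : C => filterlim s eventually (locally l)).

Definition qpow (tau beta : C) : C := cexp (2 * RtoC PI * Ci * beta * tau).

Fixpoint cprod (M : nat) (f : nat -> C) : C :=
  match M with O => 1 | S M' => cprod M' f * f M' end.

Definition qpoch (tau x : C) : C :=
  limC (fun M => cprod M (fun j => 1 - x * qpow tau (RtoC (INR j)))).

Definition zpartial (M : nat) (f : Z -> C) : C :=
  fold_right Cplus 0
    (map (fun i => f (Z.of_nat i - Z.of_nat M)%Z) (seq 0 (2 * M + 1))).

Definition theta (u tau : C) : C :=
  limC (fun M => zpartial M (fun k =>
     let nu := RtoC (IZR k + / 2)%R in
     cexp (2 * RtoC PI * Ci * nu * (u + RtoC (/ 2))) * qpow tau (nu * nu / 2))).

Fixpoint boxsum (N M : nat) (F : list Z -> C) : C :=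
  match N with
  | O => F nil
  | S N' => zpartial M (fun k => boxsum N' M (fun l => F (k :: l)))
  end.

(* Sum over n in Z^N, as the limit of the partial sums over the boxes
   [-M,M]^N (the series in question converges absolutely). *)
Definition zNsum (N : nat) (F : list Z -> C) : C :=
  limC (fun M => boxsum N M F).

Definition zabs (n : list Z) : Z := fold_right Z.add 0%Z n.

Definition in_lattice (tau z : C) : Prop :=
  exists a b : Z, z = RtoC (IZR a) + RtoC (IZR b) * tau.

Fixpoint csum_upto (N : nat) (u : nat -> C) : C :=
  match N with O => u O | S N' => csum_upto N' u + u N end.

(* The multivariable generalized mu-function
   hat mu_N(u_0,...,u_N; alpha; tau), the point (u_0,...,u_N) being given by
   u : nat -> C (only u 0, ..., u N are used); n = (n_1,...,n_N) is the list
   [n_1; ...; n_N], so n_j = nth (j-1) n 0. *)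
Definition muhat (N : nat) (u : nat -> C) (alpha tau : C) : C :=
  let U := csum_upto N u in
  let x := cexp (2 * RtoC PI * Ci * u O) in
  cexp (RtoC PI * Ci * (alpha - 1) * U) *
  zNsum N (fun n =>
    let m := RtoC (IZR (zabs n)) in
    cexp (RtoC PI * Ci * u O) * qpoch tau (x * qpow tau (alpha + m))
      / qpoch tau (x * qpow tau m) *
    cprod N (fun j =>
      let nj := nth j n 0%Z in
      let uj := u (S j) in
      (if Z.even nj then 1 else -1) *
      cexp (- (2 * RtoC PI * Ci * RtoC (IZR nj) * uj)) *
      qpow tau (RtoC (IZR (nj * (nj + 1) / 2)))
      / theta uj tau)).

Definition shift_at (r : nat) (tau : C) (u : nat -> C) : nat -> C :=
  fun i => if Nat.eqb i r then u i + tau else u i.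

(* Main.v *)
(** Up to symmetric factors, [muhat] is [(W_1 ... W_N phi) 0], where [phi n] is
    [(x q^(alpha+n);q)_oo / (x q^n;q)_oo] with [x = e^(2 pi i u_0)], and [W_j]
    averages translates, [(W_j h) k = sum_l w_j l * h (k + l)], with the
    theta-series weights [w_j l = (-1)^l y_j^(-l) q^(l(l+1)/2) / (their sum)],
    [y_j = e^(2 pi i u_j)].

    Replacing [u_j] by [u_j + tau] translates [w_j] by one step, and replacing
    [u_0] by [u_0 + tau] translates [phi] by one step; both translate the final
    sequence, which gives (a).

    For (b), the [W_j] commute, so only the exchange of [u_0] and [u_1] is left.
    Write [Theta x = (x;q)_oo (q/x;q)_oo] and
    [H x = (x q^alpha;q)_oo (q/x;q)_oo]. By quasi-periodicity of [Theta],
    [Theta x * sum_l (-1)^l y^(-l) q^(l(l+1)/2) phi l] equals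
    [sum_l (x/y)^l q^(l^2) H (x q^l)]. For a monomial [H x = x^s] the substitution
    [l -> -l-s] shows that this is symmetric in [x] and [y]; hence it is for the
    truncated products, which are Laurent polynomials, and in the limit for
    [H]. The case [alpha = 0], where [phi = 1], shows that [Theta] is
    proportional to the theta series, which is all that is needed of the triple
    product identity. *)

Require Import Defs.
From Stdlib Require Import Reals ZArith List Lra Lia FunctionalExtensionality.
From Coquelicot Require Import Coquelicot.

Open Scope C_scope.

(** * Limits and sums over the integers *)

Definition clim (s : nat -> C) (l : C) : Prop :=
  forall eps : R, (0 < eps)%R ->
  exists n0, forall n, (n0 <= n)%nat -> (Cmod (s n - l) < eps)%R.

Lemma clim_filterlim (s : nat -> C) (l : C) :
  clim s l <-> filterlim s eventually (locally l).
Proof.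
  split.
  - intros H P HP.
    destruct (@locally_norm_le_locally C_AbsRing C_NormedModule l P HP) as [eps He].
    destruct (H eps (cond_pos eps)) as [n0 Hn0].
    exists n0. intros n Hn. apply He. exact (Hn0 n Hn).
  - intros H eps Heps.
    assert (HP : locally l (fun y : C => (Cmod (y - l) < eps)%R)).
    { apply (@locally_le_locally_norm C_AbsRing C_NormedModule).
      exists (mkposreal eps Heps). intros y Hy. exact Hy. }
    destruct (H _ HP) as [n0 Hn0]. exists n0. exact Hn0.
Qed.

(** [limC] is a definite description, so its value is known only once convergence to some limit is
    proved. The evaluations of [qpoch], [theta] and [zNsum] below go through this. *)
Lemma limC_clim (s : nat -> C) (l : C) : clim s l -> limC s = l.
Proof.
  intros H. apply (@iota_filterlim_locally _ C_CompleteNormedModule).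
  - apply Proper_StrongProper, eventually_filter.
  - apply clim_filterlim, H.
Qed.

Lemma clim_unique (s : nat -> C) (l l' : C) : clim s l -> clim s l' -> l = l'.
Proof. intros H H'. rewrite <- (limC_clim _ _ H). apply limC_clim, H'. Qed.

Lemma clim_ext (s t : nat -> C) (l : C) :
  (forall n, s n = t n) -> clim s l -> clim t l.
Proof.
  intros E H eps He. destruct (H eps He) as [n0 Hn]. exists n0.
  intros n Hle. rewrite <- E. auto.
Qed.

Lemma clim_const (l : C) : clim (fun _ => l) l.
Proof.
  intros eps He. exists 0%nat. intros. unfold Cminus. rewrite Cplus_opp_r, Cmod_0. exact He.
Qed.

Lemma clim_plus (s t : nat -> C) (l m : C) :
  clim s l -> clim t m -> clim (fun n => s n + t n) (l + m).
Proof.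
  intros Hs Ht eps He.
  destruct (Hs (eps / 2)%R ltac:(lra)) as [n1 H1].
  destruct (Ht (eps / 2)%R ltac:(lra)) as [n2 H2].
  exists (n1 + n2)%nat. intros n Hn.
  replace (s n + t n - (l + m)) with ((s n - l) + (t n - m)) by ring.
  eapply Rle_lt_trans; [apply Cmod_triangle|].
  specialize (H1 n ltac:(lia)). specialize (H2 n ltac:(lia)). lra.
Qed.

Lemma clim_scal (a : C) (s : nat -> C) (l : C) :
  clim s l -> clim (fun n => a * s n) (a * l).
Proof.
  intros Hs eps He. pose proof (Cmod_ge_0 a) as Ha.
  destruct (Hs (eps / (Cmod a + 1))%R ltac:(apply Rdiv_lt_0_compat; lra)) as [n0 H].
  exists n0. intros n Hn. specialize (H n Hn).
  replace (a * s n - a * l) with (a * (s n - l)) by ring.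
  rewrite Cmod_mult.
  apply Rlt_div_r in H; [|lra].
  pose proof (Cmod_ge_0 (s n - l)). nra.
Qed.

Lemma clim_Cmod_le (s : nat -> C) (l : C) (B : R) :
  clim s l -> (forall n, (Cmod (s n) <= B)%R) -> (Cmod l <= B)%R.
Proof.
  intros Hs HB. apply le_epsilon. intros eps He.
  destruct (Hs eps He) as [n0 H]. specialize (H n0 (le_n _)). specialize (HB n0).
  replace l with (s n0 - (s n0 - l)) by ring.
  unfold Cminus at 1. eapply Rle_trans; [apply Cmod_triangle|]. rewrite Cmod_opp. lra.
Qed.

Lemma clim_shift (s : nat -> C) (l : C) :
  clim s l <-> clim (fun n => s (S n)) l.
Proof.
  split; intros H eps He; destruct (H eps He) as [n0 Hn].
  - exists n0. intros n Hle. apply Hn. lia.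
  - exists (S n0). intros [|n] Hle; [lia|]. apply Hn. lia.
Qed.

Lemma clim_mult (s t : nat -> C) (l m : C) :
  clim s l -> clim t m -> clim (fun n => s n * t n) (l * m).
Proof.
  intros Hs Ht eps He.
  pose proof (Cmod_ge_0 l) as Hl. pose proof (Cmod_ge_0 m) as Hm.
  (* With both errors below [d < 1], the three error terms add up to at most [d (|l| + |m| + 1)],
     which is less than [d (|l| + |m| + 1 + eps) = eps]. *)
  set (d := (eps / (Cmod l + Cmod m + 1 + eps))%R).
  assert (Hd : (0 < d)%R) by (apply Rdiv_lt_0_compat; lra).
  assert (Hde : (d * (Cmod l + Cmod m + 1 + eps) = eps)%R) by (unfold d; field; lra).
  assert (Hd1 : (d < 1)%R) by nra.
  destruct (Hs d Hd) as [n1 H1]. destruct (Ht d Hd) as [n2 H2].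
  exists (n1 + n2)%nat. intros n Hn.
  specialize (H1 n ltac:(lia)). specialize (H2 n ltac:(lia)).
  replace (s n * t n - l * m)
    with ((s n - l) * (t n - m) + ((s n - l) * m + l * (t n - m))) by ring.
  eapply Rle_lt_trans; [apply Cmod_triangle|].
  eapply Rle_lt_trans; [apply Rplus_le_compat_l, Cmod_triangle|].
  rewrite !Cmod_mult.
  pose proof (Cmod_ge_0 (s n - l)). pose proof (Cmod_ge_0 (t n - m)). nra.
Qed.

(** The increments form a series dominated by a geometric one, which converges by completeness; its
    partial sums telescope to [s (S n) - s 0]. *)
Lemma clim_of_geometric (s : nat -> C) (K r : R) :
  (0 <= r < 1)%R -> (forall n, (Cmod (s (S n) - s n) <= K * r ^ n)%R) ->
  exists l, clim s l.
Proof.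
  intros Hr Hs.
  assert (Hex : ex_series (V := C_CompleteNormedModule) (fun n => s (S n) - s n)).
  { apply (@ex_series_le _ C_CompleteNormedModule _ (fun n => K * r ^ n)%R).
    - exact Hs.
    - apply (ex_series_scal_l K (fun n => r ^ n)%R).
      exists (/ (1 - r))%R. apply is_series_geom. rewrite Rabs_pos_eq; lra. }
  destruct Hex as [l Hl].
  exists (l + s 0%nat). apply clim_shift.
  apply clim_ext with (s := fun n => sum_n (G := C_AbelianMonoid) (fun n => s (S n) - s n) n + s 0%nat).
  - intros n. induction n as [|n IH].
    + rewrite sum_O. ring.
    + rewrite sum_Sn. change plus with Cplus.
      replace (s (S (S n))) with (s (S (S n)) - s (S n) + s (S n)) by ring.
      rewrite <- IH. ring.
  - apply clim_plus; [|apply clim_const]. apply clim_filterlim. exact Hl.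
Qed.

(** * Symmetric partial sums and their limits *)

Lemma zpartial_0 (f : Z -> C) : zpartial 0 f = f 0%Z.
Proof. unfold zpartial. simpl. ring. Qed.

Lemma zpartial_S (M : nat) (f : Z -> C) :
  zpartial (S M) f = zpartial M f + (f (Z.of_nat (S M)) + f (- Z.of_nat (S M))%Z).
Proof.
  unfold zpartial.
  assert (Happ : forall l l' : list C,
    fold_right Cplus 0 (l ++ l') = fold_right Cplus 0 l + fold_right Cplus 0 l').
  { induction l as [|a l IH]; intros l'; simpl; [ring|]. rewrite IH. ring. }
  (* The list for [S M] is the list for [M], with its index moved by one, plus a new entry at each
     end. *)
  replace (2 * S M + 1)%nat with (S (S (2 * M + 1))) by lia.
  rewrite seq_S, map_app, Happ.
  change (seq 0 (S (2 * M + 1))) with (0%nat :: seq 1 (2 * M + 1)).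
  rewrite <- seq_shift, map_cons, map_map. cbn [fold_right map].
  rewrite (map_ext (fun x => f (Z.of_nat (S x) - Z.of_nat (S M))%Z)
                   (fun x => f (Z.of_nat x - Z.of_nat M)%Z)).
  - replace (Z.of_nat (0 + S (2 * M + 1)) - Z.of_nat (S M))%Z with (Z.of_nat (S M)) by lia.
    replace (Z.of_nat 0 - Z.of_nat (S M))%Z with (- Z.of_nat (S M))%Z by lia.
    ring.
  - intros a. f_equal. lia.
Qed.

Lemma zpartial_ext (M : nat) (f g : Z -> C) :
  (forall k, f k = g k) -> zpartial M f = zpartial M g.
Proof. intros H. f_equal. apply functional_extensionality, H. Qed.

Lemma zpartial_plus (M : nat) (f g : Z -> C) :
  zpartial M (fun k => f k + g k) = zpartial M f + zpartial M g.
Proof.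
  induction M as [|M IH]; [now rewrite !zpartial_0|].
  rewrite !zpartial_S, IH. ring.
Qed.

Lemma zpartial_scal (M : nat) (a : C) (f : Z -> C) :
  zpartial M (fun k => a * f k) = a * zpartial M f.
Proof.
  induction M as [|M IH]; [now rewrite !zpartial_0|].
  rewrite !zpartial_S, IH. ring.
Qed.

Lemma zpartial_exchange (M M' : nat) (F : Z -> Z -> C) :
  zpartial M (fun k => zpartial M' (F k)) = zpartial M' (fun l => zpartial M (fun k => F k l)).
Proof.
  induction M as [|M IH].
  - rewrite zpartial_0. apply zpartial_ext. intros l. now rewrite zpartial_0.
  - rewrite zpartial_S, IH, <- !zpartial_plus. apply zpartial_ext. intros l.
    now rewrite zpartial_S.
Qed.

Lemma zpartial_opp (M : nat) (f : Z -> C) :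
  zpartial M (fun k => f (- k)%Z) = zpartial M f.
Proof.
  induction M as [|M IH]; [now rewrite !zpartial_0|].
  rewrite !zpartial_S, IH, Z.opp_involutive. ring.
Qed.

Lemma zpartial_succ (M : nat) (f : Z -> C) :
  zpartial M (fun k => f (k + 1)%Z) =
  zpartial M f + (f (Z.of_nat M + 1)%Z - f (- Z.of_nat M)%Z).
Proof.
  induction M as [|M IH]; [rewrite !zpartial_0; simpl; ring|].
  rewrite !zpartial_S, IH.
  replace (Z.of_nat M + 1)%Z with (Z.of_nat (S M)) by lia.
  replace (- Z.of_nat (S M) + 1)%Z with (- Z.of_nat M)%Z by lia. ring.
Qed.

Definition Zsum (f : Z -> C) : C := limC (fun M => zpartial M f).

(** The sequences summed below decay faster than any exponential, so the rate can be fixed at 1 and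
    only [K] has to be uniform in families. *)
Definition expdecay (K : R) (f : Z -> C) : Prop :=
  forall k, (Cmod (f k) <= K * exp (- Rabs (IZR k)))%R.

Lemma Rabs_IZR_nat (n : nat) : Rabs (IZR (Z.of_nat n)) = INR n.
Proof. rewrite <- INR_IZR_INZ. apply Rabs_pos_eq, pos_INR. Qed.

Lemma Rabs_IZR_opp (k : Z) : Rabs (IZR (- k)) = Rabs (IZR k).
Proof. rewrite opp_IZR. apply Rabs_Ropp. Qed.

Lemma expdecay_pair (K : R) (f : Z -> C) (M : nat) : expdecay K f ->
  (Cmod (f (Z.of_nat M) + f (- Z.of_nat M)%Z) <= 2 * K * exp (- INR M))%R.
Proof.
  intros H. eapply Rle_trans; [apply Cmod_triangle|].
  pose proof (H (Z.of_nat M)) as H1. pose proof (H (- Z.of_nat M)%Z) as H2.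
  rewrite Rabs_IZR_opp, Rabs_IZR_nat in H2. rewrite Rabs_IZR_nat in H1. lra.
Qed.

Lemma exp_neg_succ (n : nat) : (2 * exp (- INR (S n)) <= exp (- INR n))%R.
Proof.
  rewrite S_INR. replace (- INR n)%R with (1 + - (INR n + 1))%R by ring.
  rewrite (exp_plus 1). pose proof (exp_ineq1 1 ltac:(lra)).
  pose proof (exp_pos (- (INR n + 1))). nra.
Qed.

Lemma expdecay_ge0 (K : R) (f : Z -> C) : expdecay K f -> (0 <= K)%R.
Proof.
  intros H. specialize (H 0%Z). rewrite Rabs_R0, Ropp_0, exp_0 in H.
  pose proof (Cmod_ge_0 (f 0%Z)). lra.
Qed.

(** By [exp_neg_succ], [exp (-(n+1)) <= exp (-n) - exp (-(n+1))], so each new pair of terms is paid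
    for by the growth of the right-hand side. *)
Lemma zpartial_tail (K : R) (f : Z -> C) (M j : nat) : expdecay K f ->
  (Cmod (zpartial (j + M) f - zpartial M f) <= 2 * K * (exp (- INR M) - exp (- INR (j + M))))%R.
Proof.
  intros H. pose proof (expdecay_ge0 _ _ H) as HK.
  induction j as [|j IH].
  - simpl. unfold Cminus. rewrite Cplus_opp_r, Cmod_0. lra.
  - change (S j + M)%nat with (S (j + M)). rewrite zpartial_S.
    pose proof (expdecay_pair K f (S (j + M)) H) as Hp.
    pose proof (exp_neg_succ (j + M)) as He.
    set (p := f (Z.of_nat (S (j + M))) + f (- Z.of_nat (S (j + M)))%Z) in *.
    replace (zpartial (j + M) f + p - zpartial M f)
      with ((zpartial (j + M) f - zpartial M f) + p) by ring.
    eapply Rle_trans; [apply Cmod_triangle|]. nra.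
Qed.

Lemma zpartial_bound (K : R) (f : Z -> C) (M : nat) : expdecay K f ->
  (Cmod (zpartial M f) <= 3 * K)%R.
Proof.
  intros H. pose proof (expdecay_ge0 _ _ H) as HK.
  pose proof (zpartial_tail K f 0 M H) as Ht.
  rewrite Nat.add_0_r, zpartial_0 in Ht. simpl INR in Ht.
  rewrite Ropp_0, exp_0 in Ht. pose proof (exp_pos (- INR M)) as Hpos.
  pose proof (H 0%Z) as H0. rewrite Rabs_R0, Ropp_0, exp_0 in H0.
  replace (zpartial M f) with ((zpartial M f - f 0%Z) + f 0%Z) by ring.
  eapply Rle_trans; [apply Cmod_triangle|]. nra.
Qed.

Lemma exp_opp_pow (n : nat) : exp (- INR n) = (exp (- 1) ^ n)%R.
Proof.
  induction n as [|n IH]; [simpl; now rewrite Ropp_0, exp_0|].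
  rewrite S_INR. replace (- (INR n + 1))%R with (- 1 + - INR n)%R by ring.
  rewrite exp_plus, IH. reflexivity.
Qed.

Lemma exp_opp_1_lt : (0 <= exp (- 1) < 1)%R.
Proof.
  split; [apply Rlt_le, exp_pos|]. rewrite <- exp_0. apply exp_increasing. lra.
Qed.

Lemma exp_opp_INR_small (eps : R) : (0 < eps)%R -> exists n0, forall n, (n0 <= n)%nat -> (exp (- INR n) < eps)%R.
Proof.
  intros He. pose proof exp_opp_1_lt.
  destruct (pow_lt_1_zero (exp (-1)) ltac:(rewrite Rabs_pos_eq; lra) eps He) as [n0 Hn].
  exists n0. intros n Hle. specialize (Hn n Hle). rewrite exp_opp_pow.
  rewrite Rabs_pos_eq in Hn; [exact Hn|]. apply pow_le; lra.
Qed.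

Lemma clim_zpartial (K : R) (f : Z -> C) : expdecay K f ->
  clim (fun M => zpartial M f) (Zsum f).
Proof.
  intros H. pose proof (expdecay_ge0 _ _ H) as HK.
  destruct (clim_of_geometric (fun M => zpartial M f) (2 * K) (exp (- 1)) exp_opp_1_lt)
    as [l Hl].
  - intros n. pose proof (zpartial_tail K f n 1 H) as Ht.
    rewrite <- exp_opp_pow. change (1 + n)%nat with (S n) in Ht.
    pose proof (Rmult_le_pos _ _ HK (Rlt_le _ _ (exp_pos (- INR (S n))))). lra.
  - unfold Zsum. now rewrite (limC_clim _ _ Hl).
Qed.

Lemma Zsum_bound (K : R) (f : Z -> C) : expdecay K f -> (Cmod (Zsum f) <= 3 * K)%R.
Proof.
  intros H. apply (clim_Cmod_le _ _ _ (clim_zpartial K f H)).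
  intros n. now apply zpartial_bound.
Qed.

Lemma Zsum_ext (f g : Z -> C) : (forall k, f k = g k) -> Zsum f = Zsum g.
Proof. intros H. f_equal. apply functional_extensionality, H. Qed.

Lemma Zsum_plus (K K' : R) (f g : Z -> C) : expdecay K f -> expdecay K' g ->
  Zsum (fun k => f k + g k) = Zsum f + Zsum g.
Proof.
  intros Hf Hg. apply limC_clim.
  apply clim_ext with (s := fun M => zpartial M f + zpartial M g).
  - intros n. now rewrite zpartial_plus.
  - apply clim_plus; eapply clim_zpartial; eassumption.
Qed.

Lemma Zsum_scal (K : R) (a : C) (f : Z -> C) : expdecay K f ->
  Zsum (fun k => a * f k) = a * Zsum f.
Proof.
  intros Hf. apply limC_clim.
  apply clim_ext with (s := fun M => a * zpartial M f).
  - intros n. now rewrite zpartial_scal.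
  - apply clim_scal. eapply clim_zpartial; eassumption.
Qed.

Lemma Zsum_opp (f : Z -> C) : Zsum (fun k => f (- k)%Z) = Zsum f.
Proof.
  unfold Zsum. f_equal. apply functional_extensionality. intros M. apply zpartial_opp.
Qed.

Lemma exp_mono (x y : R) : (x <= y)%R -> (exp x <= exp y)%R.
Proof. intros [H | ->]; [apply Rlt_le, exp_increasing, H | apply Rle_refl]. Qed.

Lemma expdecay_shift (K : R) (f : Z -> C) (m : Z) : expdecay K f ->
  expdecay (K * exp (Rabs (IZR m))) (fun k => f (k + m)%Z).
Proof.
  intros H k. pose proof (expdecay_ge0 _ _ H) as HK.
  eapply Rle_trans; [apply H|]. rewrite Rmult_assoc, <- exp_plus.
  apply Rmult_le_compat_l; [exact HK|].
  apply exp_mono. rewrite plus_IZR.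
  pose proof (Rabs_triang (IZR k + IZR m) (- IZR m)) as Ht.
  rewrite Rabs_Ropp in Ht. replace (IZR k + IZR m + - IZR m)%R with (IZR k) in Ht by ring. lra.
Qed.

Lemma expdecay_clim0 (K : R) (f : Z -> C) : expdecay K f ->
  clim (fun n => f (Z.of_nat n)) 0.
Proof.
  intros H eps He. pose proof (expdecay_ge0 _ _ H) as HK.
  destruct (exp_opp_INR_small (eps / (K + 1)) ltac:(apply Rdiv_lt_0_compat; lra)) as [n0 Hn].
  exists n0. intros n Hle. specialize (Hn n Hle). apply Rlt_div_r in Hn; [|lra].
  replace (f (Z.of_nat n) - 0) with (f (Z.of_nat n)) by ring.
  eapply Rle_lt_trans; [apply H|]. rewrite Rabs_IZR_nat.
  pose proof (exp_pos (- INR n)). nra.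
Qed.

(** Moving the window by one exchanges one boundary term at each end, and both tend to 0. *)
Lemma Zsum_succ (K : R) (f : Z -> C) : expdecay K f ->
  Zsum (fun k => f (k + 1)%Z) = Zsum f.
Proof.
  intros Hf. apply limC_clim.
  apply clim_ext with (s := fun M => zpartial M f + (f (Z.of_nat M + 1)%Z + (-1) * f (- Z.of_nat M)%Z)).
  - intros n. rewrite zpartial_succ. ring.
  - replace (Zsum f) with (Zsum f + (0 + (-1) * 0)) by ring.
    apply clim_plus; [eapply clim_zpartial; eassumption|].
    apply clim_plus.
    + eapply (expdecay_clim0 _ (fun k => f (k + 1)%Z)), expdecay_shift, Hf.
    + apply clim_scal. apply (expdecay_clim0 K (fun k => f (- k)%Z)).
      intros k. rewrite <- (Rabs_IZR_opp k). apply Hf.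
Qed.

Lemma Zsum_shift (K : R) (f : Z -> C) (m : Z) : expdecay K f ->
  Zsum (fun k => f (k + m)%Z) = Zsum f.
Proof.
  intros Hf.
  assert (Hnat : forall n g K', expdecay K' g -> Zsum (fun k => g (k + Z.of_nat n)%Z) = Zsum g).
  { induction n as [|n IH]; intros g K' Hg.
    - apply Zsum_ext. intros k. f_equal. simpl. ring.
    - rewrite <- (Zsum_succ _ g Hg). rewrite <- (IH (fun k => g (k + 1)%Z) _ (expdecay_shift _ _ 1 Hg)).
      apply Zsum_ext. intros k. f_equal. lia. }
  destruct (Z_le_gt_dec 0 m) as [Hm|Hm].
  - rewrite <- (Hnat (Z.to_nat m) f K Hf). apply Zsum_ext. intros k. f_equal. lia.
  - rewrite <- (Hnat (Z.to_nat (- m)) _ _ (expdecay_shift _ _ m Hf)).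
    apply Zsum_ext. intros k. f_equal. lia.
Qed.

(** The core of dominated convergence: a common tail bound outside a finite window, pointwise
    convergence inside it. Uniformity in [M] lets it serve both truncations that vary with [L] and
    full sums. *)
Lemma zpartial_uniformly_small (K : R) (d : nat -> Z -> C) :
  (forall L, expdecay K (d L)) -> (forall k, clim (fun L => d L k) 0) ->
  forall eps : R, (0 < eps)%R -> exists n0, forall L, (n0 <= L)%nat ->
  forall M, (Cmod (zpartial M (d L)) < eps)%R.
Proof.
  intros Hd H0 eps He. pose proof (expdecay_ge0 _ _ (Hd 0%nat)) as HK.
  (* Beyond [m] the tail costs at most [2 K exp (-m) < eps / 2]; the other half is left for the
     window. *)
  destruct (exp_opp_INR_small (eps / (4 * K + 4)) ltac:(apply Rdiv_lt_0_compat; lra)) as [m Hm].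
  specialize (Hm m (le_n _)). apply Rlt_div_r in Hm; [|lra].
  assert (Hfin : forall eps' : R, (0 < eps')%R -> exists n0, forall L, (n0 <= L)%nat ->
    forall M, (M <= m)%nat -> (Cmod (zpartial M (d L)) < eps')%R).
  { clear Hm. induction m as [|m IH]; intros eps' He'.
    - destruct (H0 0%Z eps' He') as [n0 Hn]. exists n0. intros L HL M HM.
      replace M with 0%nat by lia. rewrite zpartial_0.
      specialize (Hn L HL). replace (d L 0%Z - 0) with (d L 0%Z) in Hn by ring. exact Hn.
    - destruct (IH (eps' / 3)%R ltac:(lra)) as [n1 H1].
      destruct (H0 (Z.of_nat (S m)) (eps' / 3)%R ltac:(lra)) as [n2 H2].
      destruct (H0 (- Z.of_nat (S m))%Z (eps' / 3)%R ltac:(lra)) as [n3 H3].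
      exists (n1 + n2 + n3)%nat. intros L HL M HM.
      destruct (Nat.eq_dec M (S m)) as [->|Hne].
      + rewrite zpartial_S. specialize (H1 L ltac:(lia) m (le_n _)).
        specialize (H2 L ltac:(lia)). specialize (H3 L ltac:(lia)).
        unfold Cminus in H2, H3. rewrite Copp_0, Cplus_0_r in H2, H3.
        eapply Rle_lt_trans; [apply Cmod_triangle|].
        eapply Rle_lt_trans; [apply Rplus_le_compat_l, Cmod_triangle|]. lra.
      + specialize (H1 L ltac:(lia) M ltac:(lia)). lra. }
  destruct (Hfin (eps / 2)%R ltac:(lra)) as [n0 Hn0].
  exists n0. intros L HL M. destruct (le_dec M m) as [HM|HM].
  - specialize (Hn0 L HL M HM). lra.
  - specialize (Hn0 L HL m (le_n _)).
    pose proof (zpartial_tail K (d L) m (M - m) (Hd L)) as Ht.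
    replace (M - m + m)%nat with M in Ht by lia.
    replace (zpartial M (d L)) with ((zpartial M (d L) - zpartial m (d L)) + zpartial m (d L)) by ring.
    eapply Rle_lt_trans; [apply Cmod_triangle|].
    pose proof (exp_pos (- INR M)). pose proof (exp_pos (- INR m)). nra.
Qed.

Lemma expdecay_limit (K : R) (a : nat -> Z -> C) (f : Z -> C) :
  (forall L, expdecay K (a L)) -> (forall k, clim (fun L => a L k) (f k)) -> expdecay K f.
Proof. intros Ha Hf k. apply (clim_Cmod_le _ _ _ (Hf k)). intros L. apply Ha. Qed.

Lemma expdecay_minus (K : R) (f g : Z -> C) :
  expdecay K f -> expdecay K g -> expdecay (2 * K) (fun k => f k + (-1) * g k).
Proof.
  intros Hf Hg k. specialize (Hf k). specialize (Hg k).
  eapply Rle_trans; [apply Cmod_triangle|].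
  rewrite Cmod_mult. replace (Cmod (-1)) with 1%R; [lra|].
  rewrite Cmod_R, Rabs_left; lra.
Qed.

Lemma minus_limit_clim0 (a : nat -> Z -> C) (f : Z -> C) :
  (forall k, clim (fun L => a L k) (f k)) ->
  forall k, clim (fun L => a L k + (-1) * f k) 0.
Proof.
  intros Hf k. replace (RtoC 0) with (f k + (-1) * f k) by ring.
  apply clim_plus; [apply Hf|apply clim_const].
Qed.

(* Tannery's theorem. *)
Lemma clim_zpartial_dominated (K : R) (a : nat -> Z -> C) (f : Z -> C) :
  (forall L, expdecay K (a L)) -> (forall k, clim (fun L => a L k) (f k)) ->
  clim (fun M => zpartial M (a M)) (Zsum f).
Proof.
  intros Ha Hf. pose proof (expdecay_limit K a f Ha Hf) as Hd.
  apply clim_ext with (s := fun M => zpartial M f + zpartial M (fun k => a M k + (-1) * f k)).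
  { intros n. rewrite <- zpartial_plus. apply zpartial_ext. intros k. ring. }
  rewrite <- (Cplus_0_r (Zsum f)). apply clim_plus; [eapply clim_zpartial, Hd|].
  intros eps He.
  destruct (zpartial_uniformly_small (2 * K) (fun L k => a L k + (-1) * f k)
    (fun L => expdecay_minus _ _ _ (Ha L) Hd) (minus_limit_clim0 a f Hf) eps He) as [n0 Hn].
  exists n0. intros n Hle. unfold Cminus. rewrite Copp_0, Cplus_0_r. now apply Hn.
Qed.

Lemma clim_Zsum_dominated (K : R) (a : nat -> Z -> C) (f : Z -> C) :
  (forall L, expdecay K (a L)) -> (forall k, clim (fun L => a L k) (f k)) ->
  clim (fun L => Zsum (a L)) (Zsum f).
Proof.
  intros Ha Hf eps He. pose proof (expdecay_limit K a f Ha Hf) as Hd.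
  destruct (zpartial_uniformly_small (2 * K) (fun L k => a L k + (-1) * f k)
    (fun L => expdecay_minus _ _ _ (Ha L) Hd) (minus_limit_clim0 a f Hf) (eps / 2)
    ltac:(lra)) as [n0 Hn].
  exists n0. intros L HL.
  assert (E : Zsum (a L) - Zsum f = Zsum (fun k => a L k + (-1) * f k)).
  { assert (Hf' : expdecay K (fun k => (-1) * f k)).
    { intros k. rewrite Cmod_mult, Cmod_R, Rabs_left by lra.
      specialize (Hd k). lra. }
    rewrite (Zsum_plus K K _ _ (Ha L) Hf'), (Zsum_scal K _ _ Hd). ring. }
  rewrite E. apply Rle_lt_trans with (eps / 2)%R; [|lra].
  apply (clim_Cmod_le _ _ _ (clim_zpartial _ _ (expdecay_minus _ _ _ (Ha L) Hd))).
  intros M. apply Rlt_le, Hn, HL.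
Qed.

(** * Convolution of sequences and sums over Z^N *)

(** The rate [b] takes both signs: it bounds growth in [tame] and decay in [rapid]. *)
Definition growth_le (K b : R) (h : Z -> C) : Prop :=
  forall k, (Cmod (h k) <= K * exp (b * Rabs (IZR k)))%R.

Definition tame (h : Z -> C) : Prop := exists K b, (0 <= b)%R /\ growth_le K b h.

(** The constants are common to all [M], so that truncated sums of every size have one dominating
    sequence. *)
Definition equitame (s : nat -> Z -> C) : Prop :=
  exists K b, (0 <= b)%R /\ forall M, growth_le K b (s M).

Definition rapid (a : Z -> C) : Prop := forall b : R, exists K, growth_le K (- b) a.

(** The index is [k + l] rather than [k - l] because the summand of [muhat] depends on the sum
    [n_1 + ... + n_N]. *)
Definition conv (a h : Z -> C) (k : Z) : C := Zsum (fun l => a l * h (k + l)%Z).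

Lemma growth_le_ge0 (K b : R) (h : Z -> C) : growth_le K b h -> (0 <= K)%R.
Proof.
  intros H. specialize (H 0%Z). rewrite Rabs_R0, Rmult_0_r, exp_0 in H.
  pose proof (Cmod_ge_0 (h 0%Z)). lra.
Qed.

Lemma growth_le_mult (K K' b b' : R) (a h : Z -> C) :
  growth_le K b a -> growth_le K' b' h -> growth_le (K * K') (b + b') (fun k => a k * h k).
Proof.
  intros Ha Hh k. rewrite Cmod_mult.
  replace (K * K' * exp ((b + b') * Rabs (IZR k)))%R
    with ((K * exp (b * Rabs (IZR k))) * (K' * exp (b' * Rabs (IZR k))))%R.
  - apply Rmult_le_compat; auto using Cmod_ge_0.
  - rewrite Rmult_plus_distr_r, exp_plus. ring.
Qed.

Lemma growth_le_shift (K b : R) (h : Z -> C) (m : Z) : (0 <= b)%R ->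
  growth_le K b h -> growth_le (K * exp (b * Rabs (IZR m))) b (fun k => h (m + k)%Z).
Proof.
  intros Hb H k. pose proof (growth_le_ge0 _ _ _ H) as HK.
  eapply Rle_trans; [apply H|]. rewrite Rmult_assoc, <- exp_plus.
  apply Rmult_le_compat_l; [exact HK|]. apply exp_mono. rewrite plus_IZR.
  pose proof (Rabs_triang (IZR m) (IZR k)). nra.
Qed.

Lemma growth_le_expdecay (K : R) (f : Z -> C) : growth_le K (- (1)) f -> expdecay K f.
Proof. intros H k. replace (- Rabs (IZR k))%R with (- (1) * Rabs (IZR k))%R by ring. apply H. Qed.

Lemma rapid_expdecay (a : Z -> C) : rapid a -> exists K, expdecay K a.
Proof. intros H. destruct (H 1%R) as [K HK]. exists K. now apply growth_le_expdecay. Qed.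

Lemma rapid_mult_tame (a h : Z -> C) : rapid a -> tame h -> rapid (fun k => a k * h k).
Proof.
  intros Ha (K & b & Hb & Hh) c. destruct (Ha (c + b)%R) as [K' HK'].
  exists (K' * K)%R. replace (- c)%R with (- (c + b) + b)%R by ring.
  now apply growth_le_mult.
Qed.

Lemma rapid_scal (x : C) (a : Z -> C) : rapid a -> rapid (fun k => x * a k).
Proof.
  intros Ha b. destruct (Ha b) as [K HK]. exists (Cmod x * K)%R. intros k.
  rewrite Cmod_mult, Rmult_assoc. apply Rmult_le_compat_l; [apply Cmod_ge_0|apply HK].
Qed.

(** Decay of [a] at rate [b + 1] absorbs growth of [h] at rate [b] and leaves rate 1. The constant
    [Ka] is chosen before [h], which gives uniformity over a family of sequences. *)
Lemma conv_expdecay (a : Z -> C) (b : R) : rapid a -> (0 <= b)%R ->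
  exists Ka, forall K h, growth_le K b h ->
  forall k, expdecay (Ka * K * exp (b * Rabs (IZR k))) (fun l => a l * h (k + l)%Z).
Proof.
  intros Ha Hb. destruct (Ha (b + 1)%R) as [Ka HKa]. exists Ka. intros K h Hh k.
  apply growth_le_expdecay. rewrite Rmult_assoc.
  replace (- (1))%R with (- (b + 1) + b)%R by ring.
  apply growth_le_mult; [exact HKa|]. now apply growth_le_shift.
Qed.

(** One coordinate of a box sum: the range of [l] and the inner sequence are truncated at the same
    [M], so a diagonal limit is needed. The uniform bound is returned to allow iteration. *)
Lemma conv_clim (a : Z -> C) (s : nat -> Z -> C) (h : Z -> C) :
  rapid a -> equitame s -> (forall k, clim (fun M => s M k) (h k)) ->
  equitame (fun M k => zpartial M (fun l => a l * s M (k + l)%Z)) /\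
  forall k, clim (fun M => zpartial M (fun l => a l * s M (k + l)%Z)) (conv a h k).
Proof.
  intros Ha (K & b & Hb & Hs) Hlim. destruct (conv_expdecay a b Ha Hb) as [Ka HKa].
  split.
  - exists (3 * (Ka * K))%R, b. split; [exact Hb|]. intros M k.
    rewrite Rmult_assoc. apply zpartial_bound. now apply HKa.
  - intros k. eapply clim_zpartial_dominated.
    + intros L. apply HKa, Hs.
    + intros l. apply clim_scal, Hlim.
Qed.

Lemma conv_tame (a h : Z -> C) : rapid a -> tame h -> tame (conv a h).
Proof.
  intros Ha (K & b & Hb & Hh). destruct (conv_expdecay a b Ha Hb) as [Ka HKa].
  exists (3 * (Ka * K))%R, b. split; [exact Hb|]. intros k.
  rewrite Rmult_assoc. apply Zsum_bound. now apply HKa.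
Qed.

Lemma tame_equitame (h : Z -> C) : tame h -> equitame (fun _ => h).
Proof. intros (K & b & Hb & Hh). exists K, b. auto. Qed.

(** Both sides are limits of finite double sums over the same square [[-M,M]^2], where the order of
    summation is immaterial. *)
Lemma conv_comm (a b h : Z -> C) : rapid a -> rapid b -> tame h ->
  conv a (conv b h) = conv b (conv a h).
Proof.
  intros Ha Hb Hh. apply functional_extensionality. intros k.
  pose proof (tame_equitame h Hh) as Hu.
  destruct (conv_clim b _ h Hb Hu (fun k => clim_const (h k))) as [Ub Lb].
  destruct (conv_clim a _ h Ha Hu (fun k => clim_const (h k))) as [Ua La].
  destruct (conv_clim a _ _ Ha Ub Lb) as [_ Lab].
  destruct (conv_clim b _ _ Hb Ua La) as [_ Lba].
  apply (clim_unique _ _ _ (Lab k)). eapply clim_ext; [|exact (Lba k)].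
  intros M. cbv beta.
  transitivity (zpartial M (fun l => zpartial M (fun m => a m * (b l * h (k + l + m)%Z)))).
  - apply zpartial_ext. intros l. rewrite <- zpartial_scal. apply zpartial_ext. intros m. ring.
  - rewrite zpartial_exchange. apply zpartial_ext. intros m. rewrite <- zpartial_scal.
    apply zpartial_ext. intros l. replace (k + l + m)%Z with (k + m + l)%Z by ring. ring.
Qed.

Lemma conv_translate (a h : Z -> C) (m : Z) :
  conv a (fun k => h (k + m)%Z) = fun k => conv a h (k + m)%Z.
Proof.
  apply functional_extensionality. intros k. apply Zsum_ext. intros l.
  do 2 f_equal. ring.
Qed.

(** * Iterated convolution and box sums *)

Fixpoint iconv (N : nat) (a : nat -> Z -> C) (h : Z -> C) : Z -> C :=
  match N with
  | O => h
  | S N' => conv (a O) (iconv N' (fun j => a (S j)) h)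
  end.

Lemma iconv_tame (N : nat) (a : nat -> Z -> C) (h : Z -> C) :
  (forall j, rapid (a j)) -> tame h -> tame (iconv N a h).
Proof.
  revert a. induction N as [|N IH]; intros a Ha Hh; [exact Hh|].
  apply conv_tame; auto.
Qed.

Lemma iconv_ext (N : nat) (a a' : nat -> Z -> C) (h : Z -> C) :
  (forall j, (j < N)%nat -> a j = a' j) -> iconv N a h = iconv N a' h.
Proof.
  revert a a'. induction N as [|N IH]; intros a a' E; [reflexivity|].
  simpl. rewrite (E O) by lia. f_equal. apply IH. intros j Hj. apply E. lia.
Qed.

Lemma iconv_conv (N : nat) (a : nat -> Z -> C) (b h : Z -> C) :
  (forall j, rapid (a j)) -> rapid b -> tame h ->
  iconv N a (conv b h) = conv b (iconv N a h).
Proof.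
  revert a. induction N as [|N IH]; intros a Ha Hb Hh; [reflexivity|].
  simpl. rewrite IH by auto. apply conv_comm; auto using iconv_tame.
Qed.

Lemma iconv_translate (N : nat) (a : nat -> Z -> C) (h : Z -> C) (m : Z) :
  iconv N a (fun k => h (k + m)%Z) = fun k => iconv N a h (k + m)%Z.
Proof.
  revert a. induction N as [|N IH]; intros a; [reflexivity|].
  simpl. rewrite IH. apply conv_translate.
Qed.

Definition adj_swap (i j : nat) : nat :=
  if Nat.eqb j i then S i else if Nat.eqb j (S i) then i else j.

Lemma adj_swap_S (i j : nat) : adj_swap (S i) (S j) = S (adj_swap i j).
Proof. unfold adj_swap. simpl. destruct (j =? i), (j =? S i); reflexivity. Qed.

Lemma iconv_adj_swap (N : nat) (a : nat -> Z -> C) (h : Z -> C) (i : nat) :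
  (forall j, rapid (a j)) -> tame h -> (S i < N)%nat ->
  iconv N (fun j => a (adj_swap i j)) h = iconv N a h.
Proof.
  intros Ha Hh. revert N a Ha. induction i as [|i IH]; intros [|N] a Ha HN; try lia.
  - destruct N as [|N]; [lia|]. simpl.
    rewrite conv_comm by (auto using iconv_tame). reflexivity.
  - simpl. rewrite <- (IH N (fun j => a (S j))) by (auto; lia).
    f_equal. apply iconv_ext. intros j _. now rewrite adj_swap_S.
Qed.

Lemma cprod_ext (N : nat) (f g : nat -> C) :
  (forall j, (j < N)%nat -> f j = g j) -> cprod N f = cprod N g.
Proof.
  induction N as [|N IH]; intros E; [reflexivity|].
  simpl. rewrite E, IH by auto. reflexivity.
Qed.

Lemma cprod_first (N : nat) (f : nat -> C) : cprod (S N) f = f O * cprod N (fun j => f (S j)).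
Proof.
  induction N as [|N IH]; [simpl; ring|].
  change (cprod (S (S N)) f) with (cprod (S N) f * f (S N)). rewrite IH. simpl. ring.
Qed.

Lemma cprod_mult (N : nat) (f g : nat -> C) :
  cprod N (fun j => f j * g j) = cprod N f * cprod N g.
Proof. induction N as [|N IH]; simpl; [ring|]. rewrite IH. ring. Qed.

Lemma boxsum_ext (N M : nat) (F G : list Z -> C) :
  (forall n, F n = G n) -> boxsum N M F = boxsum N M G.
Proof. intros E. f_equal. apply functional_extensionality, E. Qed.

Lemma boxsum_S (N M : nat) (F : list Z -> C) :
  boxsum (S N) M F = zpartial M (fun k => boxsum N M (fun l => F (k :: l))).
Proof. reflexivity. Qed.

Lemma boxsum_scal (N M : nat) (x : C) (F : list Z -> C) :
  boxsum N M (fun n => x * F n) = x * boxsum N M F.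
Proof.
  revert F. induction N as [|N IH]; intros F; [reflexivity|].
  simpl. rewrite <- zpartial_scal. apply zpartial_ext. intros k. apply IH.
Qed.

(** The induction on [N] needs every base point [k], since the outer sum evaluates the inner one at
    [k + n_1], and the uniform bound, since the outer sum passes to the limit under domination. *)
Lemma boxsum_clim (N : nat) (a : nat -> Z -> C) (h : Z -> C) :
  (forall j, rapid (a j)) -> tame h ->
  let s := fun M k => boxsum N M (fun n =>
             h (k + zabs n)%Z * cprod N (fun j => a j (nth j n 0%Z))) in
  equitame s /\ forall k, clim (fun M => s M k) (iconv N a h k).
Proof.
  revert a. induction N as [|N IH]; intros a Ha Hh s.
  - assert (E : s = fun _ => h).
    { apply functional_extensionality; intros M. apply functional_extensionality; intros k.
      unfold s. simpl. rewrite Z.add_0_r. ring. }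
    rewrite E. split; [now apply tame_equitame|]. intros k. apply clim_const.
  - destruct (IH (fun j => a (S j)) (fun j => Ha (S j)) Hh) as [U L].
    destruct (conv_clim (a O) _ _ (Ha O) U L) as [U' L'].
    match type of U' with equitame ?t => assert (E : s = t) end.
    { apply functional_extensionality; intros M. apply functional_extensionality; intros k.
      unfold s. rewrite boxsum_S. apply zpartial_ext. intros l.
      rewrite <- boxsum_scal. apply boxsum_ext. intros n.
      rewrite cprod_first. simpl zabs. rewrite Z.add_assoc. simpl nth. ring. }
    rewrite E. split; assumption.
Qed.

Lemma zNsum_iconv (N : nat) (a : nat -> Z -> C) (h : Z -> C) (x : C) :
  (forall j, rapid (a j)) -> tame h ->
  zNsum N (fun n => x * (h (zabs n) * cprod N (fun j => a j (nth j n 0%Z)))) =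
  x * iconv N a h 0%Z.
Proof.
  intros Ha Hh. apply limC_clim.
  apply clim_ext with (s := fun M => x * boxsum N M (fun n =>
             h (0 + zabs n)%Z * cprod N (fun j => a j (nth j n 0%Z)))).
  - intros M. rewrite <- boxsum_scal. apply boxsum_ext. reflexivity.
  - apply clim_scal. now apply boxsum_clim.
Qed.

(** * Permutations as products of adjacent transpositions *)

Lemma adj_swap_invol (i j : nat) : adj_swap i (adj_swap i j) = j.
Proof.
  unfold adj_swap. destruct (Nat.eqb_spec j i) as [->|H1].
  - destruct (Nat.eqb_spec (S i) i); [lia|]. rewrite Nat.eqb_refl. reflexivity.
  - destruct (Nat.eqb_spec j (S i)) as [->|H2].
    + now rewrite Nat.eqb_refl.
    + destruct (Nat.eqb_spec j i); [lia|]. destruct (Nat.eqb_spec j (S i)); [lia|]. reflexivity.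
Qed.

(** Pigeonhole: the image list is duplicate-free, lies in [0, ..., N] and has [N + 1] entries, so it
    exhausts that range. *)
Lemma injective_surjective (N : nat) (sigma : nat -> nat) :
  (forall i, (i <= N)%nat -> (sigma i <= N)%nat) ->
  (forall i j, (i <= N)%nat -> (j <= N)%nat -> sigma i = sigma j -> i = j) ->
  forall m, (m <= N)%nat -> exists q, (q <= N)%nat /\ sigma q = m.
Proof.
  intros Hr Hi m Hm.
  assert (Hincl : incl (seq 0 (S N)) (map sigma (seq 0 (S N)))).
  { apply NoDup_length_incl.
    - apply NoDup_map_NoDup_ForallPairs; [|apply seq_NoDup].
      intros x y Hx Hy Hxy. apply in_seq in Hx, Hy. apply Hi; [lia|lia|exact Hxy].
    - rewrite length_map. lia.
    - intros y Hy. apply in_map_iff in Hy. destruct Hy as (x & <- & Hx).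
      apply in_seq in Hx. apply in_seq. specialize (Hr x). lia. }
  specialize (Hincl m ltac:(apply in_seq; lia)).
  apply in_map_iff in Hincl. destruct Hincl as (q & Hq & Hin).
  apply in_seq in Hin. exists q. split; [lia|exact Hq].
Qed.

(* Bubble sort: once [sigma] fixes all indices above [m], the preimage of [m]
   is moved up to [m] by adjacent swaps. *)
Lemma permutation_invariance {T V : Type} (N : nat) (D : T -> Prop) (F : (nat -> T) -> V) :
  (forall u v, (forall i, (i <= N)%nat -> u i = v i) -> F u = F v) ->
  (forall u i, (forall j, (j <= N)%nat -> D (u j)) -> (i < N)%nat ->
     F (fun j => u (adj_swap i j)) = F u) ->
  forall u sigma, (forall j, (j <= N)%nat -> D (u j)) ->
  (forall i, (i <= N)%nat -> (sigma i <= N)%nat) ->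
  (forall i j, (i <= N)%nat -> (j <= N)%nat -> sigma i = sigma j -> i = j) ->
  F (fun i => u (sigma i)) = F u.
Proof.
  intros Hext Hswap u sigma Hu.
  assert (Hbound : forall i j, (i < N)%nat -> (j <= N)%nat -> (adj_swap i j <= N)%nat).
  { intros i j Hi Hj. unfold adj_swap. destruct (Nat.eqb_spec j i), (Nat.eqb_spec j (S i)); lia. }
  assert (Hmain : forall m s,
    (forall i, (i <= N)%nat -> (s i <= N)%nat) ->
    (forall i j, (i <= N)%nat -> (j <= N)%nat -> s i = s j -> i = j) ->
    (forall i, (m <= i)%nat -> (i <= N)%nat -> s i = i) ->
    F (fun i => u (s i)) = F u).
  { induction m as [|m IHm]; intros s Hr Hi Hfix.
    - apply Hext. intros i Hle. now rewrite Hfix by lia.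
    - destruct (le_lt_dec m N) as [HmN|HmN]; [|apply IHm; auto; intros; lia].
      destruct (injective_surjective N s Hr Hi m HmN) as (q & HqN & Hq).
      assert (Hqm : (q <= m)%nat).
      { destruct (le_lt_dec q m); [assumption|]. rewrite Hfix in Hq; lia. }
      (* [d] counts the swaps still needed to bring the preimage [q] of [m] up to position [m]. *)
      remember (m - q)%nat as d eqn:Hd.
      revert s q Hr Hi Hfix HqN Hq Hqm Hd.
      induction d as [|d IHd]; intros s q Hr Hi Hfix HqN Hq Hqm Hd.
      + apply IHm; auto. intros i H1 H2. destruct (Nat.eq_dec i m) as [->|].
        * now replace q with m in Hq by lia.
        * apply Hfix; lia.
      + rewrite <- (Hswap (fun i => u (s i)) q) by (auto; lia).
        apply (IHd (fun j => s (adj_swap q j)) (S q)); try lia.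
        * intros i Hle. apply Hr, Hbound; lia.
        * intros i j H1 H2 E. apply Hi in E; [|apply Hbound; lia|apply Hbound; lia].
          rewrite <- (adj_swap_invol q i), E. apply adj_swap_invol.
        * intros i H1 H2. unfold adj_swap. destruct (Nat.eqb_spec i q); [lia|].
          destruct (Nat.eqb_spec i (S q)); [lia|]. apply Hfix; lia.
        * unfold adj_swap. rewrite Nat.eqb_refl.
          destruct (Nat.eqb_spec (S q) q); [lia|exact Hq]. }
  intros Hr Hi. apply (Hmain (S N)); auto. intros; lia.
Qed.

(** * Theta series and infinite products *)

(** Powers of [q] and of the nomes [e^(2 pi i u_j)] are all written as [e2pi] of an additive
    exponent, so that product identities become polynomial identities between exponents. *)
Definition e2pi (z : C) : C := cexp (2 * RtoC PI * Ci * z).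

Lemma cexp_plus (z w : C) : cexp (z + w) = cexp z * cexp w.
Proof.
  unfold cexp, Re, Im. destruct z as [a b], w as [c d]. simpl.
  rewrite exp_plus, cos_plus, sin_plus. apply injective_projections; simpl; ring.
Qed.

Lemma cexp_0 : cexp 0 = 1.
Proof.
  unfold cexp. simpl. rewrite exp_0, cos_0, sin_0. apply injective_projections; simpl; ring.
Qed.

Lemma Cmod_cexp (z : C) : Cmod (cexp z) = exp (Re z).
Proof.
  unfold cexp, Cmod. simpl fst. simpl snd.
  replace ((exp (Re z) * cos (Im z)) ^ 2 + (exp (Re z) * sin (Im z)) ^ 2)%R
    with (exp (Re z) ^ 2)%R.
  - apply sqrt_pow2, Rlt_le, exp_pos.
  - pose proof (sin2_cos2 (Im z)) as E. unfold Rsqr in E.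
    transitivity (exp (Re z) ^ 2 * (sin (Im z) * sin (Im z) + cos (Im z) * cos (Im z)))%R; [|ring].
    rewrite E. ring.
Qed.

Lemma cexp_neq0 (z : C) : cexp z <> 0.
Proof. apply Cmod_gt_0. rewrite Cmod_cexp. apply exp_pos. Qed.

Lemma e2pi_plus (z w : C) : e2pi (z + w) = e2pi z * e2pi w.
Proof. unfold e2pi. rewrite <- cexp_plus. f_equal. ring. Qed.

Lemma e2pi_0 : e2pi 0 = 1.
Proof. unfold e2pi. rewrite Cmult_0_r. apply cexp_0. Qed.

Lemma e2pi_neq0 (z : C) : e2pi z <> 0.
Proof. apply cexp_neq0. Qed.

Lemma Cmod_e2pi (z : C) : Cmod (e2pi z) = exp (- (2 * PI * Im z)).
Proof.
  unfold e2pi. rewrite Cmod_cexp. f_equal. destruct z as [a b]. simpl. ring.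
Qed.

Lemma e2pi_half : e2pi (/ 2) = -1.
Proof.
  unfold e2pi. replace (2 * RtoC PI * Ci * / 2) with (RtoC PI * Ci) by (field; intros E; injection E; lra).
  unfold cexp. replace (Re (RtoC PI * Ci)) with 0%R by (simpl; ring).
  replace (Im (RtoC PI * Ci)) with PI by (simpl; ring).
  rewrite exp_0, cos_PI, sin_PI. apply injective_projections; simpl; ring.
Qed.

Lemma C2_neq0 : RtoC 2 <> 0.
Proof. intros E. injection E. lra. Qed.

Lemma e2pi_IZR (k : Z) : e2pi (RtoC (IZR k)) = 1.
Proof.
  assert (H1 : e2pi 1 = 1).
  { replace (RtoC 1) with (/ 2 + / 2) at 1 by (field; apply C2_neq0).
    rewrite e2pi_plus, e2pi_half. ring. }
  induction k as [|k IH|k IH] using Z.peano_ind.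
  - apply e2pi_0.
  - rewrite succ_IZR, RtoC_plus, e2pi_plus, IH, H1. ring.
  - rewrite <- IH. replace k with (Z.succ (Z.pred k)) at 2 by lia.
    rewrite succ_IZR, RtoC_plus, e2pi_plus, H1. ring.
Qed.

(** The modulus forces [Im z = 0]; then [cos (2 pi x) = 1 - 2 sin^2 (pi x)] reduces the claim to the
    zeros of the sine. *)
Lemma e2pi_eq_1 (z : C) : e2pi z = 1 -> exists k : Z, z = RtoC (IZR k).
Proof.
  intros E.
  assert (Him : Im z = 0%R).
  { pose proof (Cmod_e2pi z) as Hm. rewrite E, Cmod_1, <- exp_0 in Hm.
    apply exp_inv in Hm. pose proof PI_RGT_0. nra. }
  destruct z as [x y]. simpl in Him. subst y.
  assert (Hcos : cos (2 * (PI * x)) = 1%R).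
  { assert (E' : e2pi (x, 0%R) = (cos (2 * (PI * x)), sin (2 * (PI * x)))).
    { unfold e2pi, cexp.
      replace (2 * RtoC PI * Ci * (x, 0%R)) with ((0, 2 * (PI * x))%R : C)
        by (apply injective_projections; simpl; ring).
      simpl Re. simpl Im. rewrite exp_0. now rewrite !Rmult_1_l. }
    rewrite E' in E. now injection E. }
  rewrite cos_2a_sin in Hcos.
  assert (Hsin : sin (PI * x) = 0%R) by nra.
  destruct (sin_eq_0_0 _ Hsin) as [k Hk]. exists k.
  pose proof PI_RGT_0. apply injective_projections; simpl; [|reflexivity].
  apply (Rmult_eq_reg_l PI); lra.
Qed.

Lemma qpow_e2pi (tau b : C) : qpow tau b = e2pi (b * tau).
Proof. unfold qpow, e2pi. f_equal. ring. Qed.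

Lemma IZR_triangle (n : Z) : IZR (n * (n + 1) / 2) = (IZR n * (IZR n + 1) / 2)%R.
Proof.
  assert (E : (n * (n + 1) = 2 * (n * (n + 1) / 2))%Z).
  { apply Z_div_exact_full_2; [lia|].
    rewrite Zmod_even, Z.even_mul, Z.add_1_r, Z.even_succ, <- Z.negb_even.
    now destruct (Z.even n). }
  apply (f_equal IZR) in E. rewrite !mult_IZR, plus_IZR in E. lra.
Qed.

Lemma sign_e2pi (n : Z) : ((if Z.even n then 1 else -1) : C) = e2pi (RtoC (IZR n) / 2).
Proof.
  destruct (Z.even n) eqn:En.
  - apply Z.even_spec in En. destruct En as [m ->].
    rewrite mult_IZR, RtoC_mult. replace (RtoC 2 * RtoC (IZR m) / 2) with (RtoC (IZR m)).
    + symmetry. apply e2pi_IZR.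
    + field; apply C2_neq0.
  - assert (Ho : Z.Odd n) by (apply Z.odd_spec; rewrite <- Z.negb_even, En; reflexivity).
    destruct Ho as [m ->].
    rewrite plus_IZR, mult_IZR, RtoC_plus, RtoC_mult.
    replace ((RtoC 2 * RtoC (IZR m) + 1) / 2) with (RtoC (IZR m) + / 2) by (field; apply C2_neq0).
    rewrite e2pi_plus, e2pi_IZR, e2pi_half. ring.
Qed.

(* The summand [(-1)^n e^(-2 pi i n v) q^(n(n+1)/2)], with the sign written as
   [e^(2 pi i n / 2)]. *)
Definition theta_term (tau v : C) (n : Z) : C :=
  e2pi (RtoC (IZR n) / 2 - RtoC (IZR n) * v + RtoC (IZR n) * (RtoC (IZR n) + 1) / 2 * tau).

Lemma Cmod_theta_term (tau v : C) (n : Z) :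
  Cmod (theta_term tau v n) =
  exp (2 * PI * IZR n * Im v - PI * Im tau * (IZR n * (IZR n + 1))).
Proof.
  unfold theta_term. rewrite Cmod_e2pi. f_equal.
  replace (RtoC (IZR n) / 2 - RtoC (IZR n) * v + RtoC (IZR n) * (RtoC (IZR n) + 1) / 2 * tau)
    with (RtoC (IZR n / 2) + (RtoC (- IZR n) * v + RtoC (IZR n * (IZR n + 1) / 2) * tau)).
  - rewrite !im_plus, !im_scal_l, im_RtoC. field.
  - rewrite RtoC_opp, !RtoC_div, RtoC_mult, RtoC_plus by lra. field; apply C2_neq0.
Qed.

Definition gaussian_le (A B K : R) (f : Z -> C) : Prop :=
  forall n, (Cmod (f n) <= K * exp (- A * (IZR n * IZR n) + B * Rabs (IZR n)))%R.

(** Completing the square: [(B + b)^2 / (4 A)] is the maximum of [-A t^2 + (B + b) t]. The constant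
    is fixed before [f], hence uniform in families. *)
Lemma gaussian_le_growth (A B K b : R) : (0 < A)%R ->
  exists K', forall f, gaussian_le A B K f -> growth_le K' (- b) f.
Proof.
  intros HA. exists (K * exp ((B + b) * (B + b) / (4 * A)))%R. intros f H n.
  assert (HK : (0 <= K)%R).
  { specialize (H 0%Z). rewrite Rabs_R0, !Rmult_0_r, Rplus_0_r, exp_0 in H.
    pose proof (Cmod_ge_0 (f 0%Z)). lra. }
  eapply Rle_trans; [apply H|]. rewrite Rmult_assoc, <- exp_plus.
  apply Rmult_le_compat_l; [exact HK|]. apply exp_mono.
  replace (IZR n * IZR n)%R with (Rabs (IZR n) * Rabs (IZR n))%R
    by (rewrite <- Rabs_mult; apply Rabs_pos_eq; nra).
  set (t := Rabs (IZR n)).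
  assert (Hsq : (0 <= A * ((t - (B + b) / (2 * A)) * (t - (B + b) / (2 * A))))%R)
    by (apply Rmult_le_pos; [lra|apply Rle_0_sqr]).
  replace (A * ((t - (B + b) / (2 * A)) * (t - (B + b) / (2 * A))))%R
    with (A * t * t - (B + b) * t + (B + b) * (B + b) / (4 * A))%R in Hsq by (field; lra).
  lra.
Qed.

Lemma mult_le_Rabs (a b : R) : (a * b <= Rabs a * Rabs b)%R.
Proof. rewrite <- Rabs_mult. apply Rle_abs. Qed.

Lemma theta_term_rapid (tau v : C) : (0 < Im tau)%R -> rapid (theta_term tau v).
Proof.
  intros Ht. pose proof PI_RGT_0 as Hpi.
  intros b. destruct (gaussian_le_growth (PI * Im tau) (2 * PI * Rabs (Im v) + PI * Im tau) 1 b)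
    as [K HK]; [nra|]. exists K. apply HK. intros n. rewrite Cmod_theta_term, Rmult_1_l. apply exp_mono.
  pose proof (mult_le_Rabs (IZR n) (Im v)) as H1.
  pose proof (Rle_abs (- IZR n)) as H2. rewrite Rabs_Ropp in H2.
  assert (H3 : (PI * Im tau * (- IZR n) <= PI * Im tau * Rabs (IZR n))%R) by (apply Rmult_le_compat_l; nra).
  nra.
Qed.

Lemma theta_term_shift (tau v : C) (n : Z) :
  theta_term tau (v + tau) n = - e2pi (- v) * theta_term tau v (n - 1).
Proof.
  replace (- e2pi (- v)) with (e2pi (/ 2) * e2pi (- v)) by (rewrite e2pi_half; ring).
  unfold theta_term. rewrite <- !e2pi_plus. f_equal.
  rewrite minus_IZR, RtoC_minus. field; apply C2_neq0.
Qed.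

Definition theta_sum (tau v : C) : C := Zsum (theta_term tau v).

Lemma theta_sum_shift (tau v : C) : (0 < Im tau)%R ->
  theta_sum tau (v + tau) = - e2pi (- v) * theta_sum tau v.
Proof.
  intros Ht. destruct (rapid_expdecay _ (theta_term_rapid tau v Ht)) as [K HK].
  unfold theta_sum. rewrite <- (Zsum_shift K _ (-1) HK).
  rewrite <- (Zsum_scal _ _ _ (expdecay_shift _ _ (-1) HK)).
  apply Zsum_ext. intros n. apply theta_term_shift.
Qed.

Lemma Cinv_0 : / RtoC 0 = 0.
Proof. unfold Cinv. apply injective_projections; simpl; unfold Rdiv; ring. Qed.

(** At [y = 0] both sides are 0 because [/ 0 = 0]; quotients by a theta series can thus be handled
    without locating its zeros. *)
Lemma Cdiv_mult_cancel (a x y : C) : a <> 0 -> (a * x) / (a * y) = x / y.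
Proof.
  intros Ha. destruct (Ceq_dec y 0) as [->|Hy].
  - rewrite Cmult_0_r. unfold Cdiv. rewrite Cinv_0. ring.
  - field. auto.
Qed.

(** Dividing by the series cancels the quasi-periodicity factor, so that [v -> v + tau] becomes an
    exact translation of the weights. *)
Definition theta_weight (tau v : C) (n : Z) : C := theta_term tau v n / theta_sum tau v.

Lemma theta_weight_rapid (tau v : C) : (0 < Im tau)%R -> rapid (theta_weight tau v).
Proof.
  intros Ht. pose proof (rapid_scal (/ theta_sum tau v) _ (theta_term_rapid tau v Ht)) as H.
  unfold theta_weight. intros b. destruct (H b) as [K HK]. exists K. intros k.
  unfold Cdiv. rewrite Cmult_comm. apply HK.
Qed.

Lemma theta_weight_shift (tau v : C) (n : Z) : (0 < Im tau)%R ->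
  theta_weight tau (v + tau) n = theta_weight tau v (n - 1).
Proof.
  intros Ht. unfold theta_weight. rewrite theta_term_shift, theta_sum_shift by exact Ht.
  apply Cdiv_mult_cancel. intros E. apply (e2pi_neq0 (- v)).
  replace (e2pi (- v)) with (- (- e2pi (- v))) by ring. rewrite E. ring.
Qed.

Lemma theta_weight_shift_Z (tau v : C) (m n : Z) : (0 < Im tau)%R ->
  theta_weight tau (v + RtoC (IZR m) * tau) n = theta_weight tau v (n - m).
Proof.
  intros Ht. revert n. induction m as [|m IH|m IH] using Z.peano_ind; intros n.
  - rewrite Cmult_0_l, Cplus_0_r, Z.sub_0_r. reflexivity.
  - rewrite succ_IZR, RtoC_plus.
    replace (v + (RtoC (IZR m) + 1) * tau) with (v + RtoC (IZR m) * tau + tau) by ring.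
    rewrite theta_weight_shift, IH by exact Ht. f_equal. lia.
  - rewrite <- Z.sub_1_r, minus_IZR, RtoC_minus.
    replace n with (n + 1 - 1)%Z at 1 by lia.
    rewrite <- theta_weight_shift by exact Ht.
    replace (v + (RtoC (IZR m) - 1) * tau + tau) with (v + RtoC (IZR m) * tau) by ring.
    rewrite IH. f_equal. lia.
Qed.

(** Put [nu = -(n + 1/2)]. Then [nu^2 / 2 = n(n+1)/2 + 1/8], and the parts of the exponent free of
    [n] give the constant factor. *)
Lemma theta_theta_sum (tau v : C) : (0 < Im tau)%R ->
  theta v tau = - Ci * qpow tau (/ 8) * cexp (- (RtoC PI * Ci * v)) * theta_sum tau v.
Proof.
  intros Ht. destruct (rapid_expdecay _ (theta_term_rapid tau v Ht)) as [K HK].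
  set (x := - Ci * qpow tau (/ 8) * cexp (- (RtoC PI * Ci * v))).
  unfold theta. apply limC_clim.
  (* With [n = - k - 1], the window [[-M, M]] for [k] is [[-M-1, M-1]] for [n], which accounts for
     the shift by [-1]. *)
  pose proof (clim_zpartial _ _ (expdecay_shift _ _ (-1) HK)) as Hl.
  rewrite (Zsum_shift K _ (-1) HK) in Hl. apply (clim_scal x) in Hl.
  eapply clim_ext; [|exact Hl].
  intros M. cbv beta. rewrite <- zpartial_opp, <- zpartial_scal. apply zpartial_ext. intros k.
  assert (HCi : - Ci = cexp (2 * RtoC PI * Ci * (- / 4))).
  { unfold cexp.
    replace (2 * RtoC PI * Ci * - / 4) with ((0, - (PI / 2))%R : C)
      by (apply injective_projections; simpl; field).
    simpl. rewrite exp_0, cos_neg, sin_neg, cos_PI2, sin_PI2.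
    apply injective_projections; simpl; ring. }
  unfold x. rewrite HCi.
  replace (cexp (- (RtoC PI * Ci * v))) with (e2pi (- (v / 2)))
    by (unfold e2pi; f_equal; field; apply C2_neq0).
  rewrite !qpow_e2pi. unfold theta_term. fold (e2pi (- / 4)).
  replace (cexp (2 * RtoC PI * Ci * RtoC (IZR k + / 2) * (v + RtoC (/ 2))))
    with (e2pi (RtoC (IZR k + / 2) * (v + RtoC (/ 2)))) by (unfold e2pi; f_equal; ring).
  (* The two exponents differ by the integer [- k - 1], which [e2pi] sends to 1. *)
  match goal with |- _ = ?y => transitivity (e2pi (RtoC (IZR (- k - 1))) * y) end;
    [|rewrite e2pi_IZR; ring].
  rewrite <- !e2pi_plus. f_equal.
  rewrite plus_IZR, minus_IZR, opp_IZR, !RtoC_plus, !RtoC_minus, !RtoC_opp, RtoC_inv by lra.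
  field.
Qed.

(** * The products [(x;q)_oo]: bounds, convergence, zeros *)

Definition fin_poch (tau v : C) (L : nat) : C :=
  cprod L (fun j => 1 - e2pi (v + RtoC (INR j) * tau)).

Definition inf_poch (tau v : C) : C := qpoch tau (e2pi v).

(** This is [|q|]. *)
Definition nome (tau : C) : R := exp (- (2 * PI * Im tau)).

Lemma nome_bounds (tau : C) : (0 < Im tau)%R -> (0 < nome tau < 1)%R.
Proof.
  intros Ht. split; [apply exp_pos|]. rewrite <- exp_0. apply exp_increasing.
  pose proof PI_RGT_0. nra.
Qed.

Lemma exp_INR_mult (x : R) (n : nat) : exp (INR n * x) = (exp x ^ n)%R.
Proof.
  induction n as [|n IH]; [now rewrite Rmult_0_l, exp_0|].
  rewrite S_INR, Rmult_plus_distr_r, exp_plus, IH, Rmult_1_l. simpl. ring.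
Qed.

Lemma Cmod_e2pi_shift (tau v : C) (j : nat) :
  Cmod (e2pi (v + RtoC (INR j) * tau)) = (Cmod (e2pi v) * nome tau ^ j)%R.
Proof.
  rewrite e2pi_plus, Cmod_mult. f_equal. rewrite Cmod_e2pi, im_scal_l. unfold nome.
  rewrite <- exp_INR_mult. f_equal. ring.
Qed.

Lemma Cmod_1_minus (z : C) : (Cmod (1 - z) <= 1 + Cmod z)%R.
Proof.
  unfold Cminus. eapply Rle_trans; [apply Cmod_triangle|]. rewrite Cmod_1, Cmod_opp. lra.
Qed.

(** Each factor is at most [1 + B |q|^j <= exp (B |q|^j)]. Keeping the partial geometric sum in the
    exponent makes the induction exact. *)
Lemma fin_poch_bound_partial (tau v : C) (L : nat) : (0 < Im tau)%R ->
  (Cmod (fin_poch tau v L) <= exp (Cmod (e2pi v) * ((1 - nome tau ^ L) / (1 - nome tau))))%R.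
Proof.
  intros Ht. pose proof (nome_bounds tau Ht) as Hr. set (B := Cmod (e2pi v)).
  assert (HB : (0 <= B)%R) by apply Cmod_ge_0.
  induction L as [|L IH].
  - unfold fin_poch. simpl. rewrite Cmod_1. unfold Rdiv.
    rewrite Rminus_diag, Rmult_0_l, Rmult_0_r, exp_0. lra.
  - unfold fin_poch in *. simpl cprod. rewrite Cmod_mult.
    replace (B * ((1 - nome tau ^ S L) / (1 - nome tau)))%R
      with (B * ((1 - nome tau ^ L) / (1 - nome tau)) + B * nome tau ^ L)%R
      by (simpl; field; lra).
    rewrite exp_plus. apply Rmult_le_compat; try apply Cmod_ge_0; [exact IH|].
    eapply Rle_trans; [apply Cmod_1_minus|]. rewrite Cmod_e2pi_shift. apply exp_ineq1_le.
Qed.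

Lemma fin_poch_bound (tau v : C) (L : nat) : (0 < Im tau)%R ->
  (Cmod (fin_poch tau v L) <= exp (Cmod (e2pi v) / (1 - nome tau)))%R.
Proof.
  intros Ht. pose proof (nome_bounds tau Ht) as Hr.
  eapply Rle_trans; [now apply fin_poch_bound_partial|]. apply exp_mono.
  pose proof (Cmod_ge_0 (e2pi v)). unfold Rdiv.
  apply Rmult_le_compat_l; [assumption|].
  pose proof (pow_le (nome tau) L ltac:(lra)).
  pose proof (Rinv_0_lt_compat (1 - nome tau) ltac:(lra)). nra.
Qed.

Lemma fin_poch_step (tau v : C) (L : nat) : (0 < Im tau)%R ->
  (Cmod (fin_poch tau v (S L) - fin_poch tau v L) <=
   exp (Cmod (e2pi v) / (1 - nome tau)) * Cmod (e2pi v) * nome tau ^ L)%R.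
Proof.
  intros Ht.
  replace (fin_poch tau v (S L) - fin_poch tau v L)
    with (fin_poch tau v L * - e2pi (v + RtoC (INR L) * tau))
    by (unfold fin_poch; simpl cprod; ring).
  rewrite Cmod_mult, Cmod_opp, Cmod_e2pi_shift, Rmult_assoc.
  apply Rmult_le_compat_r; [|now apply fin_poch_bound].
  pose proof (nome_bounds tau Ht).
  apply Rmult_le_pos; [apply Cmod_ge_0|apply pow_le; lra].
Qed.

Lemma clim_fin_poch (tau v : C) : (0 < Im tau)%R -> clim (fin_poch tau v) (inf_poch tau v).
Proof.
  intros Ht. pose proof (nome_bounds tau Ht) as Hr.
  destruct (clim_of_geometric (fin_poch tau v) _ (nome tau) ltac:(lra)
             (fun L => fin_poch_step tau v L Ht)) as [l Hl].
  replace (inf_poch tau v) with l; [exact Hl|]. symmetry. apply limC_clim.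
  eapply clim_ext; [|exact Hl]. intros L. apply cprod_ext. intros j _.
  now rewrite qpow_e2pi, e2pi_plus.
Qed.

Lemma inf_poch_minus_1 (tau v : C) : (0 < Im tau)%R ->
  (Cmod (inf_poch tau v - 1) <=
   exp (Cmod (e2pi v) / (1 - nome tau)) * (Cmod (e2pi v) / (1 - nome tau)))%R.
Proof.
  intros Ht. pose proof (nome_bounds tau Ht) as Hr.
  set (B := Cmod (e2pi v)). set (E := exp (B / (1 - nome tau))).
  assert (HB : (0 <= B)%R) by apply Cmod_ge_0.
  assert (HE : (0 < E)%R) by apply exp_pos.
  assert (Hpart : forall L, (Cmod (fin_poch tau v L - 1) <=
            E * (B * ((1 - nome tau ^ L) / (1 - nome tau))))%R).
  { induction L as [|L IH].
    - unfold fin_poch. simpl cprod. unfold Cminus, Rdiv. rewrite Cplus_opp_r, Cmod_0. simpl. lra.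
    - replace (fin_poch tau v (S L) - 1)
        with ((fin_poch tau v (S L) - fin_poch tau v L) + (fin_poch tau v L - 1)) by ring.
      eapply Rle_trans; [apply Cmod_triangle|].
      pose proof (fin_poch_step tau v L Ht) as Hs. fold B E in Hs.
      replace (B * ((1 - nome tau ^ S L) / (1 - nome tau)))%R
        with (B * ((1 - nome tau ^ L) / (1 - nome tau)) + B * nome tau ^ L)%R
        by (simpl; field; lra).
      lra. }
  apply (clim_Cmod_le (fun L => fin_poch tau v L + -1)).
  - apply (clim_plus _ _ _ (- (1)) (clim_fin_poch tau v Ht)).
    replace (- (1)) with (RtoC (-1)) by ring. apply clim_const.
  - intros L. replace (fin_poch tau v L + -1) with (fin_poch tau v L - 1) by ring.
    eapply Rle_trans; [apply Hpart|].
    apply Rmult_le_compat_l; [lra|]. unfold Rdiv.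
    apply Rmult_le_compat_l; [assumption|].
    pose proof (pow_le (nome tau) L ltac:(lra)).
    pose proof (Rinv_0_lt_compat (1 - nome tau) ltac:(lra)). nra.
Qed.

Lemma fin_poch_first (tau v : C) (L : nat) :
  fin_poch tau v (S L) = (1 - e2pi v) * fin_poch tau (v + tau) L.
Proof.
  unfold fin_poch. rewrite cprod_first. simpl INR at 1. rewrite Cmult_0_l, Cplus_0_r. f_equal.
  apply cprod_ext. intros j _. rewrite S_INR, RtoC_plus. do 2 f_equal. ring.
Qed.

Lemma inf_poch_first (tau v : C) : (0 < Im tau)%R ->
  inf_poch tau v = (1 - e2pi v) * inf_poch tau (v + tau).
Proof.
  intros Ht. apply (clim_unique (fun L => fin_poch tau v (S L))).
  - apply (clim_shift (fin_poch tau v)). now apply clim_fin_poch.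
  - eapply clim_ext; [intros L; symmetry; apply fin_poch_first|].
    apply clim_scal. now apply clim_fin_poch.
Qed.

Lemma inf_poch_split (tau v : C) (L : nat) : (0 < Im tau)%R ->
  inf_poch tau v = fin_poch tau v L * inf_poch tau (v + RtoC (INR L) * tau).
Proof.
  intros Ht. induction L as [|L IH].
  - unfold fin_poch. simpl. rewrite Cmult_0_l, Cplus_0_r. ring.
  - rewrite IH, (inf_poch_first tau (v + RtoC (INR L) * tau) Ht).
    unfold fin_poch. simpl cprod. rewrite S_INR, RtoC_plus.
    replace (v + (RtoC (INR L) + 1) * tau) with (v + RtoC (INR L) * tau + tau) by ring. ring.
Qed.

(* After splitting off finitely many factors the remaining product is close to 1. *)
Lemma inf_poch_neq0 (tau v : C) : (0 < Im tau)%R ->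
  (forall j : nat, e2pi (v + RtoC (INR j) * tau) <> 1) -> inf_poch tau v <> 0.
Proof.
  intros Ht Hv. pose proof (nome_bounds tau Ht) as Hr.
  set (B := Cmod (e2pi v)). assert (HB : (0 <= B)%R) by apply Cmod_ge_0.
  (* This [L] makes [X = B |q|^L / (1 - |q|)] at most [1/4], so the tail product is within
     [X exp X <= 3/4] of 1. *)
  destruct (pow_lt_1_zero (nome tau) ltac:(rewrite Rabs_pos_eq; lra)
    ((1 - nome tau) / (4 * (B + 1)))%R ltac:(apply Rdiv_lt_0_compat; lra)) as [L HL].
  specialize (HL L (le_n _)). rewrite Rabs_pos_eq in HL by (apply pow_le; lra).
  rewrite (inf_poch_split tau v L Ht). apply Cmult_neq_0.
  - clear HL. induction L as [|L IH]; [unfold fin_poch; simpl; intros E; injection E; lra|].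
    unfold fin_poch. simpl cprod. apply Cmult_neq_0; [exact IH|].
    intros E. apply (Hv L). replace (e2pi (v + RtoC (INR L) * tau))
      with (1 - (1 - e2pi (v + RtoC (INR L) * tau))) by ring. rewrite E. ring.
  - intros E. pose proof (inf_poch_minus_1 tau (v + RtoC (INR L) * tau) Ht) as H.
    rewrite E, Cmod_e2pi_shift in H. fold B in H.
    replace (Cmod (0 - 1)) with 1%R in H
      by (replace (0 - 1) with (- (1)) by ring; now rewrite Cmod_m1).
    set (X := (B * nome tau ^ L / (1 - nome tau))%R) in *.
    assert (HX : (X <= / 4)%R).
    { unfold X. apply Rle_div_l; [lra|]. apply Rlt_div_r in HL; [|lra].
      pose proof (pow_le (nome tau) L ltac:(lra)). nra. }
    assert (H0X : (0 <= X)%R).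
    { unfold X. apply Rdiv_le_0_compat; [|lra]. apply Rmult_le_pos; [assumption|].
      apply pow_le; lra. }
    assert (Hexp : (exp X <= 3)%R).
    { apply Rle_trans with (exp 1); [apply exp_mono; lra|apply exp_le_3]. }
    nra.
Qed.

(** * Exchange symmetry *)

(** The first factors, where [q^(-j)] is large, are peeled off one at a time: each is at most [1 + B
    |q|^(-j) <= exp (B + 2 pi j Im tau)], and these exponents add up to [m B + pi Im tau m(m+1)]. *)
Lemma fin_poch_bound_neg (tau v : C) (m L : nat) : (0 < Im tau)%R ->
  (Cmod (fin_poch tau (v - RtoC (INR m) * tau) L) <=
   exp (Cmod (e2pi v) / (1 - nome tau) + INR m * Cmod (e2pi v)
        + PI * Im tau * (INR m * (INR m + 1))))%R.
Proof.
  intros Ht. pose proof (nome_bounds tau Ht) as Hr. pose proof PI_RGT_0 as Hpi.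
  set (B := Cmod (e2pi v)). assert (HB : (0 <= B)%R) by apply Cmod_ge_0.
  assert (HX : (0 <= B / (1 - nome tau))%R) by (apply Rdiv_le_0_compat; lra).
  assert (Hs : (0 < PI * Im tau)%R) by nra.
  revert L. induction m as [|m IH]; intros L.
  - simpl INR. rewrite Cmult_0_l. unfold Cminus. rewrite Copp_0, Cplus_0_r.
    rewrite !Rmult_0_l, Rmult_0_r, !Rplus_0_r. now apply fin_poch_bound.
  - pose proof (pos_INR m) as Hm. rewrite S_INR. destruct L as [|L].
    + unfold fin_poch. simpl cprod. rewrite Cmod_1.
      apply Rle_trans with (exp 0); [rewrite exp_0; lra|apply exp_mono].
      assert (0 <= (INR m + 1) * B)%R by (apply Rmult_le_pos; lra).
      assert (0 <= PI * Im tau * ((INR m + 1) * (INR m + 1 + 1)))%R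
        by (apply Rmult_le_pos; [lra|apply Rmult_le_pos; lra]). lra.
    + rewrite fin_poch_first.
      replace (v - RtoC (INR m + 1) * tau + tau) with (v - RtoC (INR m) * tau)
        by (rewrite RtoC_plus; ring).
      rewrite Cmod_mult.
      replace (B / (1 - nome tau) + (INR m + 1) * B + PI * Im tau * ((INR m + 1) * (INR m + 1 + 1)))%R
        with ((B + 2 * (PI * Im tau) * (INR m + 1)) +
              (B / (1 - nome tau) + INR m * B + PI * Im tau * (INR m * (INR m + 1))))%R by ring.
      rewrite exp_plus. apply Rmult_le_compat; try apply Cmod_ge_0; [|apply IH].
      eapply Rle_trans; [apply Cmod_1_minus|].
      unfold Cminus. rewrite e2pi_plus, Cmod_mult. fold B.
      replace (Cmod (e2pi (- (RtoC (INR m + 1) * tau))))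
        with (exp (2 * (PI * Im tau) * (INR m + 1)))
        by (rewrite Cmod_e2pi, im_opp, im_scal_l; f_equal; ring).
      rewrite exp_plus.
      assert (H1 : (1 <= exp (2 * (PI * Im tau) * (INR m + 1)))%R)
        by (apply Rle_trans with (exp 0); [rewrite exp_0; lra|apply exp_mono; nra]).
      pose proof (exp_ineq1_le B). nra.
Qed.

(* [n^2 - n |n|] is [0] for [n >= 0] and [2 n^2] for [n < 0]: the product only
   grows in the direction where [|q^n|] does. *)
Lemma fin_poch_growth (tau v : C) : (0 < Im tau)%R ->
  exists K b, (0 <= b)%R /\ forall L n,
  (Cmod (fin_poch tau (v + RtoC (IZR n) * tau) L) <=
   K * exp (b * Rabs (IZR n) + PI * Im tau / 2 * (IZR n * IZR n - IZR n * Rabs (IZR n))))%R.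
Proof.
  intros Ht. pose proof (nome_bounds tau Ht) as Hr. pose proof PI_RGT_0 as Hpi.
  set (B := Cmod (e2pi v)). assert (HB : (0 <= B)%R) by apply Cmod_ge_0.
  assert (Hs : (0 < PI * Im tau)%R) by nra.
  exists (exp (B / (1 - nome tau))), (B + PI * Im tau)%R. split; [lra|]. intros L n.
  rewrite <- exp_plus. destruct (Z_le_gt_dec 0 n) as [Hn|Hn].
  - rewrite <- (Z2Nat.id n Hn). set (m := Z.to_nat n).
    rewrite Rabs_IZR_nat, <- INR_IZR_INZ.
    eapply Rle_trans; [now apply fin_poch_bound|]. apply exp_mono.
    rewrite Cmod_e2pi_shift. fold B. pose proof (pos_INR m).
    assert (Hpow : (nome tau ^ m <= 1)%R).
    { rewrite <- (pow1 m). apply pow_incr. lra. }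
    assert (H1 : (B * nome tau ^ m / (1 - nome tau) <= B / (1 - nome tau))%R).
    { unfold Rdiv. apply Rmult_le_compat_r; [apply Rlt_le, Rinv_0_lt_compat; lra|]. nra. }
    assert (H2 : (0 <= (B + PI * Im tau) * INR m)%R) by (apply Rmult_le_pos; lra).
    lra.
  - replace n with (- Z.of_nat (Z.to_nat (- n)))%Z by lia. set (m := Z.to_nat (- n)).
    rewrite Rabs_IZR_opp, Rabs_IZR_nat, opp_IZR, <- INR_IZR_INZ, RtoC_opp.
    replace (v + - RtoC (INR m) * tau) with (v - RtoC (INR m) * tau) by ring.
    eapply Rle_trans; [now apply fin_poch_bound_neg|]. apply exp_mono. fold B.
    apply Req_le. field. lra.
Qed.

Lemma tame_ext (h g : Z -> C) : (forall k, h k = g k) -> tame h -> tame g.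
Proof. intros E H. now replace g with h by (apply functional_extensionality, E). Qed.

Lemma tame_mult (h g : Z -> C) : tame h -> tame g -> tame (fun k => h k * g k).
Proof.
  intros (K & b & Hb & Hh) (K' & b' & Hb' & Hg). exists (K * K')%R, (b + b')%R.
  split; [lra|]. now apply growth_le_mult.
Qed.

Lemma tame_plus (h g : Z -> C) : tame h -> tame g -> tame (fun k => h k + g k).
Proof.
  intros (K & b & Hb & Hh) (K' & b' & Hb' & Hg). exists (K + K')%R, (b + b')%R.
  split; [lra|]. intros k. eapply Rle_trans; [apply Cmod_triangle|].
  pose proof (growth_le_ge0 _ _ _ Hh) as HK. pose proof (growth_le_ge0 _ _ _ Hg) as HK'.
  rewrite Rmult_plus_distr_r. pose proof (Rabs_pos (IZR k)) as Hk.
  apply Rplus_le_compat.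
  - eapply Rle_trans; [apply Hh|]. apply Rmult_le_compat_l; [exact HK|]. apply exp_mono. nra.
  - eapply Rle_trans; [apply Hg|]. apply Rmult_le_compat_l; [exact HK'|]. apply exp_mono. nra.
Qed.

Lemma tame_const (x : C) : tame (fun _ => x).
Proof.
  exists (Cmod x), 0%R. split; [lra|]. intros k. rewrite Rmult_0_l, exp_0. lra.
Qed.

Lemma tame_e2pi (tau x : C) (s : Z) :
  tame (fun n => e2pi (RtoC (IZR s) * (x + RtoC (IZR n) * tau))).
Proof.
  exists (exp (- (2 * PI * (IZR s * Im x)))), (Rabs (2 * PI * IZR s * Im tau)).
  split; [apply Rabs_pos|]. intros n.
  rewrite Cmod_e2pi, im_scal_l, im_plus, im_scal_l, <- exp_plus. apply exp_mono.
  pose proof (mult_le_Rabs (- (2 * PI * IZR s * Im tau)) (IZR n)) as H.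
  rewrite Rabs_Ropp in H. lra.
Qed.

Lemma rapid_tame (a : Z -> C) : rapid a -> tame a.
Proof.
  intros Ha. destruct (Ha 0%R) as [K HK]. exists K, 0%R. split; [lra|].
  rewrite Ropp_0 in HK. exact HK.
Qed.

Lemma rapid_opp (a : Z -> C) : rapid a -> rapid (fun n => a (- n)%Z).
Proof.
  intros Ha b. destruct (Ha b) as [K HK]. exists K. intros n.
  rewrite <- Rabs_IZR_opp. apply HK.
Qed.

(** * Symmetry of the kernel sums *)

Definition theta_pair (tau x y : C) (n : Z) : C := theta_term tau y n * theta_term tau x (- n).

Lemma theta_pair_rapid (tau x y : C) : (0 < Im tau)%R -> rapid (theta_pair tau x y).
Proof.
  intros Ht. apply rapid_mult_tame; [now apply theta_term_rapid|].
  now apply rapid_tame, (rapid_opp (theta_term tau x)), theta_term_rapid.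
Qed.

(** The two exponents combine to [n (x - y) + n^2 tau]: [theta_pair] is the factor [(x/y)^n q^(n^2)]
    in additive notation. *)
Lemma Cmod_theta_pair (tau x y : C) (n : Z) :
  Cmod (theta_pair tau x y n) =
  exp (2 * PI * IZR n * (Im y - Im x) - 2 * PI * Im tau * (IZR n * IZR n)).
Proof.
  unfold theta_pair. rewrite Cmod_mult, !Cmod_theta_term, <- exp_plus, opp_IZR. f_equal. ring.
Qed.

Definition kernel_sum (tau : C) (H : C -> C) (x y : C) : C :=
  Zsum (fun n => theta_pair tau x y n * H (x + RtoC (IZR n) * tau)).

(* Multiplying by the exponentials [e2pi (s v)] makes the symmetry stable under
   multiplication of [H] by Laurent polynomials in [e2pi v]. *)
Definition symmetric_kernel (tau : C) (H : C -> C) : Prop :=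
  (forall x, tame (fun n => H (x + RtoC (IZR n) * tau))) /\
  forall s x y,
    kernel_sum tau (fun v => e2pi (RtoC (IZR s) * v) * H v) x y =
    kernel_sum tau (fun v => e2pi (RtoC (IZR s) * v) * H v) y x.

Lemma symmetric_kernel_1 (tau : C) : (0 < Im tau)%R -> symmetric_kernel tau (fun _ => 1).
Proof.
  intros Ht. split; [intros x; apply tame_const|]. intros s x y. unfold kernel_sum.
  set (g := fun n => theta_pair tau y x n * (e2pi (RtoC (IZR s) * (y + RtoC (IZR n) * tau)) * 1)).
  assert (Hg : rapid g).
  { apply rapid_mult_tame; [now apply theta_pair_rapid|].
    apply (tame_mult _ (fun _ => 1)); [apply tame_e2pi|apply tame_const]. }
  destruct (rapid_expdecay _ (rapid_opp g Hg)) as [K HK].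
  (* The full exponent is [n (x - y) + s x + n(n+s) tau]; it is unchanged when [n -> -n-s] and [x],
     [y] are exchanged. Reflection followed by a shift by [s] is this substitution. *)
  rewrite <- (Zsum_opp g), <- (Zsum_shift K _ s HK). apply Zsum_ext. intros n.
  unfold g, theta_pair, theta_term. rewrite !Cmult_1_r, <- !e2pi_plus. f_equal.
  rewrite !Z.opp_involutive, !opp_IZR, !plus_IZR, !RtoC_opp, !RtoC_plus. field.
  all: apply C2_neq0.
Qed.

(** By linearity the kernel sum with exponent [s] splits into those of [H] with exponents [s] and
    [s + t], both symmetric. *)
Lemma symmetric_kernel_mult (tau : C) (H : C -> C) (A : C) (t : Z) : (0 < Im tau)%R ->
  symmetric_kernel tau H ->
  symmetric_kernel tau (fun v => (1 - A * e2pi (RtoC (IZR t) * v)) * H v).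
Proof.
  intros Ht [Htame Hsym]. split.
  - intros x. apply tame_mult; [|apply Htame].
    apply (tame_ext (fun n => 1 + (- A) * e2pi (RtoC (IZR t) * (x + RtoC (IZR n) * tau)))).
    + intros k. ring.
    + apply tame_plus; [apply tame_const|]. apply tame_mult; [apply tame_const|apply tame_e2pi].
  - intros s x y.
    assert (Hdec : forall s' x' y', exists K, expdecay K (fun n => theta_pair tau x' y' n *
        (e2pi (RtoC (IZR s') * (x' + RtoC (IZR n) * tau)) * H (x' + RtoC (IZR n) * tau)))).
    { intros s' x' y'. apply rapid_expdecay, rapid_mult_tame; [now apply theta_pair_rapid|].
      apply tame_mult; [apply tame_e2pi|apply Htame]. }
    assert (Hlin : forall x' y',
      kernel_sum tau (fun v => e2pi (RtoC (IZR s) * v) *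
        ((1 - A * e2pi (RtoC (IZR t) * v)) * H v)) x' y' =
      kernel_sum tau (fun v => e2pi (RtoC (IZR s) * v) * H v) x' y' +
      (- A) * kernel_sum tau (fun v => e2pi (RtoC (IZR (s + t)) * v) * H v) x' y').
    { intros x' y'. destruct (Hdec s x' y') as [K1 HK1]. destruct (Hdec (s + t)%Z x' y') as [K2 HK2].
      unfold kernel_sum. rewrite <- (Zsum_scal _ (- A) _ HK2).
      erewrite <- Zsum_plus.
      - apply Zsum_ext. intros n. rewrite plus_IZR, RtoC_plus, Cmult_plus_distr_r, e2pi_plus. ring.
      - exact HK1.
      - intros k. rewrite Cmod_mult.
        eapply Rle_trans; [apply Rmult_le_compat_l; [apply Cmod_ge_0|apply HK2]|].
        rewrite <- Rmult_assoc. apply Rle_refl. }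
    rewrite !Hlin, (Hsym s x y), (Hsym (s + t)%Z x y). reflexivity.
Qed.

Definition fin_num (tau alpha : C) (L : nat) (v : C) : C :=
  fin_poch tau (v + alpha * tau) L * fin_poch tau (tau - v) L.

(** The function [H] of the overview at [e2pi v]; [fin_num] is its truncation, a Laurent polynomial
    in [e2pi v]. *)
Definition inf_num (tau alpha v : C) : C :=
  inf_poch tau (v + alpha * tau) * inf_poch tau (tau - v).

Lemma symmetric_kernel_ext (tau : C) (H H' : C -> C) :
  (forall v, H v = H' v) -> symmetric_kernel tau H -> symmetric_kernel tau H'.
Proof. intros E HS. now replace H' with H by (apply functional_extensionality, E). Qed.

Lemma fin_num_symmetric (tau alpha : C) (L : nat) : (0 < Im tau)%R ->
  symmetric_kernel tau (fin_num tau alpha L).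
Proof.
  intros Ht.
  assert (Hpoch : forall (t : Z) (w : C) M H, symmetric_kernel tau H ->
    symmetric_kernel tau (fun v => fin_poch tau (w + RtoC (IZR t) * v) M * H v)).
  { intros t w M H HS. induction M as [|M IH].
    - eapply symmetric_kernel_ext; [|exact HS]. intros v. unfold fin_poch. simpl. ring.
    - eapply symmetric_kernel_ext;
        [|exact (symmetric_kernel_mult tau _ (e2pi (w + RtoC (INR M) * tau)) t Ht IH)].
      intros v. cbv beta. unfold fin_poch. simpl cprod.
      replace (w + RtoC (IZR t) * v + RtoC (INR M) * tau)
        with ((w + RtoC (INR M) * tau) + RtoC (IZR t) * v) by ring.
      rewrite (e2pi_plus (w + RtoC (INR M) * tau)). ring. }
  (* The factors in [e2pi (-v)] are adjoined first, then those in [e2pi v], starting from the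
     constant 1. *)
  pose proof (Hpoch 1%Z (alpha * tau) L _ (Hpoch (-1)%Z tau L _ (symmetric_kernel_1 tau Ht))) as HS.
  eapply symmetric_kernel_ext; [|exact HS].
  intros v. unfold fin_num. cbv beta. rewrite Cmult_1_r.
  f_equal; f_equal; ring.
Qed.

(** The two products grow in opposite directions: [n^2 - n|n|] and [n^2 + n|n|] add up to [2 n^2].
    The resulting rate [pi Im tau] is half the Gaussian decay rate of [theta_pair]. *)
Lemma fin_num_growth (tau alpha x : C) : (0 < Im tau)%R ->
  exists K b, (0 <= b)%R /\ forall L n,
  (Cmod (fin_num tau alpha L (x + RtoC (IZR n) * tau)) <=
   K * exp (b * Rabs (IZR n) + PI * Im tau * (IZR n * IZR n)))%R.
Proof.
  intros Ht.
  destruct (fin_poch_growth tau (x + alpha * tau) Ht) as (K1 & b1 & Hb1 & H1).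
  destruct (fin_poch_growth tau (tau - x) Ht) as (K2 & b2 & Hb2 & H2).
  exists (K1 * K2)%R, (b1 + b2)%R. split; [lra|]. intros L n.
  unfold fin_num. rewrite Cmod_mult.
  replace (x + RtoC (IZR n) * tau + alpha * tau)
    with (x + alpha * tau + RtoC (IZR n) * tau) by ring.
  replace (tau - (x + RtoC (IZR n) * tau)) with (tau - x + RtoC (IZR (- n)) * tau)
    by (rewrite opp_IZR, RtoC_opp; ring).
  specialize (H1 L n). specialize (H2 L (- n)%Z). rewrite Rabs_IZR_opp, opp_IZR in H2.
  rewrite opp_IZR.
  eapply Rle_trans; [apply Rmult_le_compat; [apply Cmod_ge_0|apply Cmod_ge_0|exact H1|exact H2]|].
  rewrite Rmult_assoc, (Rmult_assoc K1 K2), <- (Rmult_assoc _ K2), (Rmult_comm _ K2), (Rmult_assoc K2).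
  rewrite <- exp_plus. apply Req_le. do 3 f_equal. field.
Qed.

Lemma clim_fin_num (tau alpha v : C) : (0 < Im tau)%R ->
  clim (fun L => fin_num tau alpha L v) (inf_num tau alpha v).
Proof. intros Ht. apply clim_mult; now apply clim_fin_poch. Qed.

Lemma kernel_sum_inf_num_sym (tau alpha x y : C) : (0 < Im tau)%R ->
  kernel_sum tau (inf_num tau alpha) x y = kernel_sum tau (inf_num tau alpha) y x.
Proof.
  intros Ht. pose proof PI_RGT_0 as Hpi.
  assert (Hlim : forall x y, clim (fun L => kernel_sum tau (fin_num tau alpha L) x y)
            (kernel_sum tau (inf_num tau alpha) x y)).
  { clear x y. intros x y. destruct (fin_num_growth tau alpha x Ht) as (K & b & Hb & HK).
    (* Kernel decay [2 pi Im tau] minus growth [pi Im tau] leaves a Gaussian of rate [pi Im tau],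
       uniformly in [L]. *)
    destruct (gaussian_le_growth (PI * Im tau) (2 * PI * Rabs (Im y - Im x) + b) K 1)
      as [K' HK']; [nra|].
    apply (clim_Zsum_dominated K').
    - intros L. apply growth_le_expdecay, HK'. intros n.
      rewrite Cmod_mult, Cmod_theta_pair.
      eapply Rle_trans; [apply Rmult_le_compat_l; [apply Rlt_le, exp_pos|apply HK]|].
      rewrite <- Rmult_assoc, (Rmult_comm _ K), Rmult_assoc, <- exp_plus.
      assert (HK0 : (0 <= K)%R).
      { specialize (HK 0%nat 0%Z). rewrite Rabs_R0, !Rmult_0_r, Rplus_0_r, exp_0 in HK.
        pose proof (Cmod_ge_0 (fin_num tau alpha 0 (x + RtoC 0 * tau))). lra. }
      apply Rmult_le_compat_l; [exact HK0|]. apply exp_mono.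
      pose proof (mult_le_Rabs (IZR n) (Im y - Im x)). nra.
    - intros n. apply clim_scal. now apply clim_fin_num. }
  apply (clim_unique _ _ _ (Hlim x y)).
  eapply clim_ext; [|exact (Hlim y x)]. intros L.
  destruct (fin_num_symmetric tau alpha L Ht) as [_ Hsym].
  specialize (Hsym 0%Z x y).
  replace (fun v => e2pi (RtoC 0 * v) * fin_num tau alpha L v) with (fin_num tau alpha L) in Hsym.
  - symmetry. exact Hsym.
  - apply functional_extensionality. intros v. rewrite Cmult_0_l, e2pi_0. ring.
Qed.

(** * Exchange of two variables *)

Definition theta_prod (tau v : C) : C := inf_poch tau v * inf_poch tau (tau - v).

Definition poch_ratio (tau alpha x : C) (n : Z) : C :=
  inf_poch tau (x + RtoC (IZR n) * tau + alpha * tau) / inf_poch tau (x + RtoC (IZR n) * tau).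

Lemma not_in_lattice_shift (tau x : C) (m : Z) :
  ~ in_lattice tau x -> ~ in_lattice tau (x + RtoC (IZR m) * tau).
Proof.
  intros Hx (a & b & E). apply Hx. exists a, (b - m)%Z.
  rewrite minus_IZR, RtoC_minus.
  replace x with (x + RtoC (IZR m) * tau - RtoC (IZR m) * tau) by ring. rewrite E. ring.
Qed.

Lemma e2pi_neq_1 (tau x : C) (m : Z) :
  ~ in_lattice tau x -> e2pi (x + RtoC (IZR m) * tau) <> 1.
Proof.
  intros Hx E. destruct (e2pi_eq_1 _ E) as [k Hk].
  apply (not_in_lattice_shift tau x m Hx). exists k, 0%Z. rewrite Hk. ring.
Qed.

Lemma inf_poch_neq0_lattice (tau x : C) : (0 < Im tau)%R -> ~ in_lattice tau x ->
  inf_poch tau x <> 0.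
Proof.
  intros Ht Hx. apply inf_poch_neq0; [exact Ht|]. intros j.
  rewrite INR_IZR_INZ. now apply e2pi_neq_1.
Qed.

Lemma theta_prod_neq0 (tau x : C) : (0 < Im tau)%R -> ~ in_lattice tau x ->
  theta_prod tau x <> 0.
Proof.
  intros Ht Hx. apply Cmult_neq_0; apply inf_poch_neq0_lattice; try assumption.
  intros (a & b & E). apply Hx. exists (- a)%Z, (1 - b)%Z.
  rewrite opp_IZR, minus_IZR, RtoC_opp, RtoC_minus.
  replace x with (tau - (tau - x)) by ring. rewrite E. ring.
Qed.

Lemma theta_prod_shift (tau x : C) : (0 < Im tau)%R -> ~ in_lattice tau x ->
  theta_prod tau (x + tau) = - e2pi (- x) * theta_prod tau x.
Proof.
  intros Ht Hx. unfold theta_prod.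
  rewrite (inf_poch_first tau x Ht).
  replace (tau - (x + tau)) with (- x) by ring. rewrite (inf_poch_first tau (- x) Ht).
  replace (- x + tau) with (tau - x) by ring.
  assert (E : e2pi (- x) * e2pi x = 1).
  { rewrite <- e2pi_plus. replace (- x + x) with (RtoC 0) by ring. apply e2pi_0. }
  transitivity ((1 - e2pi (- x)) * inf_poch tau (x + tau) * inf_poch tau (tau - x)); [ring|].
  transitivity ((e2pi (- x) * e2pi x - e2pi (- x)) * inf_poch tau (x + tau) * inf_poch tau (tau - x));
    [rewrite E|]; ring.
Qed.

Lemma theta_prod_shift_Z (tau x : C) (n : Z) : (0 < Im tau)%R -> ~ in_lattice tau x ->
  theta_prod tau x = theta_term tau x (- n) * theta_prod tau (x + RtoC (IZR n) * tau).
Proof.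
  intros Ht Hx.
  (* The right-hand side of the claim does not depend on [n]; induction in both directions then
     reduces it to [n = 0]. *)
  assert (Hstep : forall n, theta_term tau x (- (n + 1)) * theta_prod tau (x + RtoC (IZR (n + 1)) * tau)
    = theta_term tau x (- n) * theta_prod tau (x + RtoC (IZR n) * tau)).
  { clear n. intros n.
    replace (x + RtoC (IZR (n + 1)) * tau) with (x + RtoC (IZR n) * tau + tau)
      by (rewrite plus_IZR, RtoC_plus; ring).
    rewrite theta_prod_shift by auto using not_in_lattice_shift.
    replace (- e2pi (- (x + RtoC (IZR n) * tau)))
      with (e2pi (/ 2) * e2pi (- (x + RtoC (IZR n) * tau))) by (rewrite e2pi_half; ring).
    rewrite !Cmult_assoc. f_equal. unfold theta_term. rewrite <- !e2pi_plus. f_equal.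
    rewrite !opp_IZR, plus_IZR, !RtoC_opp, !RtoC_plus. field. all: apply C2_neq0. }
  induction n as [|n IH|n IH] using Z.peano_ind.
  - rewrite Cmult_0_l, Cplus_0_r. unfold theta_term. simpl.
    replace (0 / 2 - 0 * x + 0 * (0 + 1) / 2 * tau) with (RtoC 0) by (field; apply C2_neq0).
    rewrite e2pi_0. ring.
  - rewrite <- Z.add_1_r, Hstep. exact IH.
  - rewrite IH, <- (Hstep (Z.pred n)). replace (Z.pred n + 1)%Z with n by lia. reflexivity.
Qed.

(** After moving the theta product to [x + n tau], one of its two factors cancels the denominator of
    the ratio and the other completes the numerator to [inf_num]. *)
Lemma theta_prod_poch_ratio (tau alpha x : C) (n : Z) : (0 < Im tau)%R -> ~ in_lattice tau x ->
  theta_prod tau x * poch_ratio tau alpha x n =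
  theta_term tau x (- n) * inf_num tau alpha (x + RtoC (IZR n) * tau).
Proof.
  intros Ht Hx. rewrite (theta_prod_shift_Z tau x n Ht Hx).
  unfold poch_ratio, theta_prod, inf_num. field.
  apply inf_poch_neq0_lattice; auto using not_in_lattice_shift.
Qed.

(** The Gaussian decay of [theta_term tau x (- n)] cancels the quadratic growth of [inf_num]
    exactly, leaving a linear exponent. *)
Lemma poch_ratio_tame (tau alpha x : C) : (0 < Im tau)%R -> ~ in_lattice tau x ->
  tame (poch_ratio tau alpha x).
Proof.
  intros Ht Hx. pose proof PI_RGT_0 as Hpi.
  pose proof (theta_prod_neq0 tau x Ht Hx) as Hp.
  destruct (fin_num_growth tau alpha x Ht) as (K & b & Hb & HK).
  assert (HK' : forall n, (Cmod (inf_num tau alpha (x + RtoC (IZR n) * tau)) <=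
     K * exp (b * Rabs (IZR n) + PI * Im tau * (IZR n * IZR n)))%R).
  { intros n. apply (clim_Cmod_le _ _ _ (clim_fin_num tau alpha _ Ht)). intros L. apply HK. }
  apply (tame_ext (fun n => / theta_prod tau x *
    (theta_term tau x (- n) * inf_num tau alpha (x + RtoC (IZR n) * tau)))).
  { intros n. rewrite <- theta_prod_poch_ratio by assumption. field. exact Hp. }
  apply tame_mult; [apply tame_const|].
  exists K, (2 * PI * Rabs (Im x) + PI * Im tau + b)%R.
  pose proof (Rabs_pos (Im x)). split; [nra|]. intros n.
  rewrite Cmod_mult, Cmod_theta_term.
  eapply Rle_trans; [apply Rmult_le_compat_l; [apply Rlt_le, exp_pos|apply HK']|].
  rewrite <- Rmult_assoc, (Rmult_comm _ K), Rmult_assoc, <- exp_plus.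
  assert (HK0 : (0 <= K)%R).
  { specialize (HK' 0%Z). rewrite Rabs_R0, !Rmult_0_r, Rplus_0_r, exp_0 in HK'.
    pose proof (Cmod_ge_0 (inf_num tau alpha (x + RtoC 0 * tau))). lra. }
  apply Rmult_le_compat_l; [exact HK0|]. apply exp_mono. rewrite opp_IZR.
  pose proof (mult_le_Rabs (- IZR n) (Im x)) as H1. rewrite Rabs_Ropp in H1.
  pose proof (Rle_abs (IZR n)) as H2.
  assert (H3 : (PI * Im tau * IZR n <= PI * Im tau * Rabs (IZR n))%R)
    by (apply Rmult_le_compat_l; nra).
  nra.
Qed.

Lemma theta_prod_kernel (tau alpha x y : C) : (0 < Im tau)%R -> ~ in_lattice tau x ->
  theta_prod tau x * Zsum (fun n => theta_term tau y n * poch_ratio tau alpha x n) =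
  kernel_sum tau (inf_num tau alpha) x y.
Proof.
  intros Ht Hx.
  destruct (rapid_expdecay _ (rapid_mult_tame _ _ (theta_term_rapid tau y Ht)
    (poch_ratio_tame tau alpha x Ht Hx))) as [K HK].
  rewrite <- (Zsum_scal _ _ _ HK). apply Zsum_ext. intros n. unfold theta_pair.
  rewrite <- Cmult_assoc, <- theta_prod_poch_ratio by assumption. ring.
Qed.

(* Jacobi's triple product up to a constant factor: the case [alpha = 0]. *)
Lemma theta_prod_sum_sym (tau x y : C) : (0 < Im tau)%R ->
  ~ in_lattice tau x -> ~ in_lattice tau y ->
  theta_prod tau x * theta_sum tau y = theta_prod tau y * theta_sum tau x.
Proof.
  intros Ht Hx Hy.
  assert (H : forall x y, ~ in_lattice tau x ->
    theta_prod tau x * theta_sum tau y = kernel_sum tau (inf_num tau 0) x y).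
  { clear x y Hx Hy. intros x y Hx. rewrite <- theta_prod_kernel by assumption. f_equal.
    apply Zsum_ext. intros n. unfold poch_ratio. rewrite Cmult_0_l, Cplus_0_r. field.
    apply inf_poch_neq0_lattice; auto using not_in_lattice_shift. }
  rewrite (H x y Hx), (H y x Hy). now apply kernel_sum_inf_num_sym.
Qed.

Lemma Cinv_mult_total (x y : C) : / (x * y) = / x * / y.
Proof.
  destruct (Ceq_dec x 0) as [->|Hx]; [rewrite Cmult_0_l, Cinv_0; ring|].
  destruct (Ceq_dec y 0) as [->|Hy]; [rewrite Cmult_0_r, Cinv_0; ring|].
  field. auto.
Qed.

(* No non-vanishing of [theta_sum] is needed: [/ 0 = 0], and by
   [theta_prod_sum_sym] it vanishes at [x] iff it vanishes at [y]. *)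
Lemma weight_poch_ratio_sym_0 (tau alpha x y : C) : (0 < Im tau)%R ->
  ~ in_lattice tau x -> ~ in_lattice tau y ->
  Zsum (fun n => theta_weight tau y n * poch_ratio tau alpha x n) =
  Zsum (fun n => theta_weight tau x n * poch_ratio tau alpha y n).
Proof.
  intros Ht.
  assert (H : forall x y, ~ in_lattice tau x ->
    Zsum (fun n => theta_weight tau y n * poch_ratio tau alpha x n) =
    / (theta_prod tau x * theta_sum tau y) * kernel_sum tau (inf_num tau alpha) x y).
  { clear x y. intros x y Hx. rewrite <- theta_prod_kernel by assumption.
    destruct (rapid_expdecay _ (rapid_mult_tame _ _ (theta_term_rapid tau y Ht)
      (poch_ratio_tame tau alpha x Ht Hx))) as [K HK].
    transitivity (/ theta_sum tau y * Zsum (fun n => theta_term tau y n * poch_ratio tau alpha x n)).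
    - rewrite <- (Zsum_scal _ _ _ HK). apply Zsum_ext. intros n. unfold theta_weight, Cdiv. ring.
    - rewrite Cinv_mult_total.
      transitivity ((/ theta_prod tau x * theta_prod tau x) * (/ theta_sum tau y *
        Zsum (fun n => theta_term tau y n * poch_ratio tau alpha x n))); [|ring].
      rewrite Cinv_l by now apply theta_prod_neq0. ring. }
  intros Hx Hy. rewrite (H x y Hx), (H y x Hy).
  rewrite (theta_prod_sum_sym tau x y) by assumption.
  rewrite (kernel_sum_inf_num_sym tau alpha x y Ht). reflexivity.
Qed.

Lemma poch_ratio_shift (tau alpha x : C) (m n : Z) :
  poch_ratio tau alpha (x + RtoC (IZR m) * tau) n = poch_ratio tau alpha x (m + n).
Proof.
  unfold poch_ratio. rewrite plus_IZR, RtoC_plus.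
  replace (x + RtoC (IZR m) * tau + RtoC (IZR n) * tau)
    with (x + (RtoC (IZR m) + RtoC (IZR n)) * tau) by ring. reflexivity.
Qed.

(** The value at [k] is the value at 0 for [x + k tau]. After the exchange this shift sits in the
    weights, translating them by [k], and a change of summation index moves it to the ratio. *)
Lemma conv_weight_poch_ratio_sym (tau alpha x y : C) : (0 < Im tau)%R ->
  ~ in_lattice tau x -> ~ in_lattice tau y ->
  conv (theta_weight tau y) (poch_ratio tau alpha x) =
  conv (theta_weight tau x) (poch_ratio tau alpha y).
Proof.
  intros Ht Hx Hy. apply functional_extensionality. intros k. unfold conv.
  transitivity (Zsum (fun l => theta_weight tau y l *
                 poch_ratio tau alpha (x + RtoC (IZR k) * tau) l)).
  { apply Zsum_ext. intros l. now rewrite poch_ratio_shift. }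
  rewrite weight_poch_ratio_sym_0 by auto using not_in_lattice_shift.
  destruct (rapid_expdecay _ (rapid_mult_tame _ _ (theta_weight_rapid tau (x + RtoC (IZR k) * tau) Ht)
      (poch_ratio_tame tau alpha y Ht Hy))) as [K HK].
  rewrite <- (Zsum_shift _ _ k HK). apply Zsum_ext. intros l.
  rewrite theta_weight_shift_Z by exact Ht. f_equal; f_equal; ring.
Qed.

(** * Assembling [muhat] from convolutions *)

Lemma csum_upto_ext (N : nat) (u v : nat -> C) :
  (forall i, (i <= N)%nat -> u i = v i) -> csum_upto N u = csum_upto N v.
Proof.
  induction N as [|N IH]; intros E; simpl; [now apply E|].
  rewrite IH, E by auto. reflexivity.
Qed.

Lemma csum_upto_first (N : nat) (u : nat -> C) :
  csum_upto (S N) u = u O + csum_upto N (fun i => u (S i)).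
Proof.
  induction N as [|N IH]; [reflexivity|].
  change (csum_upto (S (S N)) u) with (csum_upto (S N) u + u (S (S N))).
  rewrite IH. simpl. ring.
Qed.

Lemma csum_upto_adj_swap (N i : nat) (u : nat -> C) : (i < N)%nat ->
  csum_upto N (fun j => u (adj_swap i j)) = csum_upto N u.
Proof.
  revert N u. induction i as [|i IH]; intros [|N] u Hi; try lia.
  - destruct N as [|N]; [simpl; unfold adj_swap; simpl; ring|].
    rewrite !csum_upto_first. unfold adj_swap at 1 2. simpl.
    replace (csum_upto N (fun i => u (adj_swap 0 (S (S i))))) with (csum_upto N (fun i => u (S (S i))))
      by reflexivity. ring.
  - rewrite !csum_upto_first, <- (IH N (fun j => u (S j))) by lia. f_equal.
    apply csum_upto_ext. intros j _. now rewrite adj_swap_S.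
Qed.

Lemma csum_upto_shift_at (N r : nat) (tau : C) (u : nat -> C) : (r <= N)%nat ->
  csum_upto N (shift_at r tau u) = csum_upto N u + tau.
Proof.
  revert r u. induction N as [|N IH]; intros r u Hr.
  - replace r with O by lia. reflexivity.
  - rewrite !csum_upto_first. destruct r as [|r].
    + rewrite (csum_upto_ext N (fun i => shift_at 0 tau u (S i)) (fun i => u (S i))) by reflexivity.
      unfold shift_at. simpl. ring.
    + rewrite (csum_upto_ext N (fun i => shift_at (S r) tau u (S i))
        (shift_at r tau (fun i => u (S i)))) by reflexivity.
      rewrite IH by lia. unfold shift_at. simpl. ring.
Qed.

(* The factors [e^(pi i u_j)] coming from [theta] turn the prefactor of [muhat]
   into a symmetric function of the [u_j]. *)
Definition mu_conv (N : nat) (u : nat -> C) (alpha tau : C) : C :=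
  cexp (RtoC PI * Ci * alpha * csum_upto N u) * (cprod N (fun _ => / (- Ci * qpow tau (/ 8))) *
  iconv N (fun j => theta_weight tau (u (S j))) (poch_ratio tau alpha (u O)) 0%Z).

Lemma cexp_csum_upto (N : nat) (a : C) (u : nat -> C) :
  cexp (a * u O) * cprod N (fun j => cexp (a * u (S j))) = cexp (a * csum_upto N u).
Proof.
  induction N as [|N IH]; simpl; [ring|].
  rewrite Cmult_plus_distr_l, cexp_plus, <- IH. ring.
Qed.

Lemma theta_summand_weight (tau v : C) (n : Z) : (0 < Im tau)%R ->
  (if Z.even n then 1 else -1) * cexp (- (2 * RtoC PI * Ci * RtoC (IZR n) * v)) *
  qpow tau (RtoC (IZR (n * (n + 1) / 2))) / theta v tau =
  cexp (RtoC PI * Ci * v) * / (- Ci * qpow tau (/ 8)) * theta_weight tau v n.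
Proof.
  intros Ht. rewrite sign_e2pi, theta_theta_sum, qpow_e2pi, IZR_triangle by exact Ht.
  replace (cexp (- (2 * RtoC PI * Ci * RtoC (IZR n) * v))) with (e2pi (- (RtoC (IZR n) * v)))
    by (unfold e2pi; f_equal; ring).
  rewrite <- !e2pi_plus. unfold theta_weight, theta_term, Cdiv.
  rewrite !Cinv_mult_total.
  replace (/ cexp (- (RtoC PI * Ci * v))) with (cexp (RtoC PI * Ci * v)).
  - replace (RtoC (IZR n) * / 2 + - (RtoC (IZR n) * v) + RtoC (IZR n * (IZR n + 1) / 2) * tau)
      with (RtoC (IZR n) * / 2 - RtoC (IZR n) * v + RtoC (IZR n) * (RtoC (IZR n) + 1) * / 2 * tau).
    + ring.
    + rewrite RtoC_div, RtoC_mult, RtoC_plus by lra. field.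
  - assert (E : cexp (RtoC PI * Ci * v) * cexp (- (RtoC PI * Ci * v)) = 1).
    { rewrite <- cexp_plus, Cplus_opp_r. apply cexp_0. }
    rewrite <- (Cmult_1_l (/ _)), <- E. field. apply cexp_neq0.
Qed.

Lemma muhat_mu_conv (N : nat) (u : nat -> C) (alpha tau : C) : (0 < Im tau)%R ->
  ~ in_lattice tau (u O) -> muhat N u alpha tau = mu_conv N u alpha tau.
Proof.
  intros Ht Hu. unfold muhat, mu_conv. cbv zeta.
  set (kappa := / (- Ci * qpow tau (/ 8))).
  (* [x] collects the part of the summand that does not depend on [n]. *)
  set (x := cexp (RtoC PI * Ci * u O) * cprod N (fun j => cexp (RtoC PI * Ci * u (S j)) * kappa)).
  transitivity (cexp (RtoC PI * Ci * (alpha - 1) * csum_upto N u) *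
    zNsum N (fun n => x * (poch_ratio tau alpha (u O) (zabs n) *
       cprod N (fun j => theta_weight tau (u (S j)) (nth j n 0%Z))))).
  - f_equal. f_equal. apply functional_extensionality. intros n.
    set (m := RtoC (IZR (zabs n))).
    replace (cexp (2 * RtoC PI * Ci * u O) * qpow tau (alpha + m))
      with (e2pi (u O + m * tau + alpha * tau))
      by (rewrite qpow_e2pi; fold (e2pi (u O)); rewrite <- e2pi_plus; f_equal; ring).
    replace (cexp (2 * RtoC PI * Ci * u O) * qpow tau m) with (e2pi (u O + m * tau))
      by (rewrite qpow_e2pi, e2pi_plus; reflexivity).
    unfold x.
    rewrite (cprod_ext N _ (fun j => cexp (RtoC PI * Ci * u (S j)) * kappa *
                                     theta_weight tau (u (S j)) (nth j n 0%Z))).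
    + rewrite (cprod_mult N (fun j => cexp (RtoC PI * Ci * u (S j)) * kappa)).
      unfold poch_ratio, inf_poch, Cdiv. fold m. ring.
    + intros j _. apply theta_summand_weight; assumption.
  - rewrite (zNsum_iconv N (fun j => theta_weight tau (u (S j))) (poch_ratio tau alpha (u O))).
    + unfold x. rewrite cprod_mult.
      (* The half-period exponentials in [x] multiply to [e^(pi i u)], which turns [alpha - 1] in
         the prefactor into [alpha]. *)
      replace (cexp (RtoC PI * Ci * alpha * csum_upto N u))
        with (cexp (RtoC PI * Ci * (alpha - 1) * csum_upto N u) * cexp (RtoC PI * Ci * csum_upto N u))
        by (rewrite <- cexp_plus; f_equal; ring).
      rewrite <- (cexp_csum_upto N (RtoC PI * Ci) u). ring.
    + intros j. now apply theta_weight_rapid.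
    + now apply poch_ratio_tame.
Qed.

(** At the translated coordinate, [sum_l a (l-1) g (k+l) = sum_l a l g (k+1+l)]; the remaining
    convolutions commute with translation. *)
Lemma iconv_shift_weight (N j : nat) (a : nat -> Z -> C) (h : Z -> C) :
  (forall i, rapid (a i)) -> tame h -> (j < N)%nat ->
  iconv N (fun i n => if Nat.eqb i j then a i (n - 1)%Z else a i n) h =
  fun k => iconv N a h (k + 1)%Z.
Proof.
  revert j a. induction N as [|N IH]; intros j a Ha Hh Hj; [lia|].
  destruct j as [|j]; simpl.
  - apply functional_extensionality. intros k. unfold conv.
    set (g := iconv N (fun i => a (S i)) h).
    assert (Hg : tame g) by (apply iconv_tame; auto).
    destruct Hg as (K & b & Hb & Hg).
    destruct (conv_expdecay (a O) b (Ha O) Hb) as [Ka HKa].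
    rewrite <- (Zsum_shift _ _ (-1) (HKa K g Hg (k + 1)%Z)).
    apply Zsum_ext. intros l. f_equal. change (g (k + l)%Z = g (k + 1 + (l + -1))%Z). f_equal. ring.
  - change (fun n => a O n) with (a O).
    rewrite (IH j (fun i => a (S i))) by (auto; lia).
    apply conv_translate.
Qed.

(** Whichever variable moves, the iterated convolution is read at index 1 instead of 0. The
    right-hand side is free of [r], which yields part (a). *)
Lemma mu_conv_shift_at (N r : nat) (u : nat -> C) (alpha tau : C) : (0 < Im tau)%R ->
  ~ in_lattice tau (u O) -> (r <= N)%nat ->
  mu_conv N (shift_at r tau u) alpha tau =
  cexp (RtoC PI * Ci * alpha * (csum_upto N u + tau)) *
  (cprod N (fun _ => / (- Ci * qpow tau (/ 8))) *
   iconv N (fun j => theta_weight tau (u (S j))) (poch_ratio tau alpha (u O)) 1%Z).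
Proof.
  intros Ht Hu Hr. unfold mu_conv. rewrite csum_upto_shift_at by exact Hr. do 2 f_equal.
  destruct r as [|r].
  - change (fun j => theta_weight tau (shift_at 0 tau u (S j)))
      with (fun j => theta_weight tau (u (S j))).
    change (shift_at 0 tau u O) with (u O + tau).
    assert (E : poch_ratio tau alpha (u O + tau) = fun k => poch_ratio tau alpha (u O) (k + 1)%Z).
    { apply functional_extensionality. intros k.
      replace (u O + tau) with (u O + RtoC (IZR 1) * tau) by ring.
      rewrite poch_ratio_shift. f_equal. ring. }
    rewrite E, iconv_translate. reflexivity.
  - change (shift_at (S r) tau u O) with (u O).
    pose proof (iconv_shift_weight N r (fun j => theta_weight tau (u (S j)))
      (poch_ratio tau alpha (u O)) (fun i => theta_weight_rapid tau _ Ht)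
      (poch_ratio_tame tau alpha _ Ht Hu) ltac:(lia)) as E.
    apply (f_equal (fun f => f 0%Z)) in E. rewrite Z.add_0_l in E. rewrite <- E.
    apply (f_equal (fun f => f 0%Z)), iconv_ext. intros j _.
    apply functional_extensionality. intros n. unfold shift_at. simpl.
    destruct (Nat.eqb j r); [|reflexivity]. now apply theta_weight_shift.
Qed.

Lemma mu_conv_ext (N : nat) (u v : nat -> C) (alpha tau : C) :
  (forall i, (i <= N)%nat -> u i = v i) -> mu_conv N u alpha tau = mu_conv N v alpha tau.
Proof.
  intros E. unfold mu_conv. rewrite (csum_upto_ext N u v E), (E O) by lia.
  rewrite (iconv_ext N (fun j => theta_weight tau (u (S j))) (fun j => theta_weight tau (v (S j)))).
  - reflexivity.
  - intros j Hj. now rewrite E by lia.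
Qed.

Lemma mu_conv_adj_swap (N i : nat) (u : nat -> C) (alpha tau : C) : (0 < Im tau)%R ->
  (forall j, (j <= N)%nat -> ~ in_lattice tau (u j)) -> (i < N)%nat ->
  mu_conv N (fun j => u (adj_swap i j)) alpha tau = mu_conv N u alpha tau.
Proof.
  intros Ht Hu Hi. unfold mu_conv. rewrite csum_upto_adj_swap by exact Hi. do 2 f_equal.
  assert (Hw : forall v : nat -> C, forall j, rapid (theta_weight tau (v j)))
    by (intros v j; now apply theta_weight_rapid).
  assert (Hp : forall j, (j <= N)%nat -> tame (poch_ratio tau alpha (u j)))
    by (intros j Hj; apply poch_ratio_tame; auto).
  destruct i as [|i].
  - destruct N as [|N]; [lia|]. simpl.
    change (u (adj_swap 0 0)) with (u 1%nat). change (u (adj_swap 0 1)) with (u O).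
    change (fun j => theta_weight tau (u (adj_swap 0 (S (S j)))))
      with (fun j => theta_weight tau (u (S (S j)))).
    (* The outermost weight is moved inside all the others so that it acts directly on the ratio,
       where the two-variable exchange applies. *)
    rewrite <- !iconv_conv by (auto with arith; intros; now apply theta_weight_rapid).
    rewrite conv_weight_poch_ratio_sym by auto with arith. reflexivity.
  (* A swap away from [u 0] only permutes two commuting weights. *)
  - change (u (adj_swap (S i) 0)) with (u O).
    rewrite <- (iconv_adj_swap N (fun j => theta_weight tau (u (S j))) _ i)
      by (auto with arith; intros; now apply theta_weight_rapid).
    apply (f_equal (fun f => f 0%Z)), iconv_ext. intros j _. now rewrite adj_swap_S.
Qed.

Theorem theorem1p1 (N : nat) (alpha tau : C) (u : nat -> C) :
  (0 < Im tau)%R ->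
  (1 <= N)%nat ->
  (forall i, (i <= N)%nat -> ~ in_lattice tau (u i)) ->
  (forall r s, (r <= N)%nat -> (s <= N)%nat ->
     muhat N (shift_at r tau u) alpha tau = muhat N (shift_at s tau u) alpha tau)
  /\
  (forall sigma : nat -> nat,
     (forall i, (i <= N)%nat -> (sigma i <= N)%nat) ->
     (forall i j, (i <= N)%nat -> (j <= N)%nat -> sigma i = sigma j -> i = j) ->
     muhat N u alpha tau = muhat N (fun i => u (sigma i)) alpha tau).
Proof.
  intros Ht _ Hu. assert (Hu0 : ~ in_lattice tau (u O)) by (apply Hu; lia). split.
  (* Rewriting [muhat] as [mu_conv] requires the zeroth entry of the shifted point to avoid the
     lattice; for [r = 0] that entry is [u 0 + tau]. *)
  - assert (H : forall r, (r <= N)%nat -> ~ in_lattice tau (shift_at r tau u O)).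
    { intros [|r] _; [|exact Hu0].
      change (shift_at 0 tau u O) with (u O + tau).
      replace (u O + tau) with (u O + RtoC (IZR 1) * tau) by ring.
      now apply not_in_lattice_shift. }
    intros r s Hr Hs. rewrite !muhat_mu_conv, !mu_conv_shift_at by auto. reflexivity.
  - intros sigma Hr Hi. rewrite !muhat_mu_conv by auto with arith. symmetry.
    apply (permutation_invariance N (fun z => ~ in_lattice tau z)
             (fun u => mu_conv N u alpha tau)); try assumption.
    + intros v w. apply mu_conv_ext.
    + intros v i Hv Hlt. now apply mu_conv_adj_swap.
Qed.
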